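(* For every integer $n\ge1$, the capacity-achieving input distribution $P_{X^\ast}$ of the binomial channel with $n$ trials satisfies \[ |\mathrm{supp}(P_{X^\ast})|\ge \max\left\{2,\ e^{C(n)},\ \frac18\sqrt{n\,\log^{+}\!\left(\frac{\log\!\left(\frac{n\pi}{2e}\right)}{37850}\right)}\right\}, \] where $\log^+(x)=\max\{0,\log x\}$. In particular $|\mathrm{supp}(P_{X^\ast})|=\Omega(\sqrt{n\log\log n})$ as $n\to\infty$.
   Context: All logarithms are natural. For an integer $n\ge1$, the binomial channel has input $X\in[0,1]$, output $Y\in\{0,\dots,n\}$ and transition law $P_{Y|X}(y|x)=\binom{n}{y}x^y(1-x)^{n-y}$. Its capacity is $C(n)=\max_{P_X} I(X;Y)$ over probability distributions $P_X$ on $[0,1]$; the maximizer $P_{X^\ast}$ (capacity-achieving input distribution) is unique and discrete with finitely many mass points. $\mathrm{supp}(P)$ denotes the support of a distribution $P$, i.e. the set of $x$ such that every open set containing $x$ has positive probability. *)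

(* Defs.v *)
From HB Require Import structures.
From mathcomp Require Import all_boot all_order all_algebra.
From mathcomp Require Import all_classical all_reals all_analysis.
Set Implicit Arguments. Unset Strict Implicit. Unset Printing Implicit Defensive.
Import Order.TTheory GRing.Theory Num.Theory.
Import numFieldNormedType.Exports.
Local Open Scope classical_set_scope.
Local Open Scope ring_scope.

Definition binW {R : realType} (n y : nat) (x : R) : R :=
  ('C(n, y))%:R * x ^+ y * (1 - x) ^+ (n - y).

Definition input_distr {R : realType} (P : probability R R) : Prop :=
  P (~` `[(0%R:R), (1%R:R)]%classic) = 0%E.

Definition out_prob {R : realType} (n : nat) (P : probability R R) (y : nat) : R :=
  fine (\int[P]_(x in `[(0%R:R), (1%R:R)]%classic) (binW n y x)%:E)%E.

Definition xlogxq {R : realType} (t q : R) : R :=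
  if t == 0 then 0 else t * ln (t / q).

Definition mutual_info {R : realType} (n : nat) (P : probability R R) : R :=
  \sum_(y < n.+1)
    fine (\int[P]_(x in `[(0%R:R), (1%R:R)]%classic)
            (xlogxq (binW n y x) (out_prob n P y))%:E)%E.

Definition capacity_achieving {R : realType} (n : nat) (P : probability R R) : Prop :=
  input_distr P /\
  forall Q : probability R R, input_distr Q -> mutual_info n Q <= mutual_info n P.

Definition supp {R : realType} (P : probability R R) : set R :=
  [set x | forall U : set R, open U -> U x -> (0 < P U)%E].

(* log^+ x = max{0, log x}, taken to be 0 when x <= 1 (in particular for
   x <= 0, where log is undefined). *)
Definition logplus {R : realType} (x : R) : R := if x <= 1 then 0 else ln x.

Definition theorem4_bound {R : realType} (n : nat) (C : R) : R :=
  Num.max 2 (Num.max (expR C)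
    ((8 : R)^-1 * Num.sqrt (n%:R * logplus (ln (n%:R * pi / (2 * expR 1)) / (50 * 757 : R))))).

(* Main.v *)
(** Let [W_x] be the binomial law, [Q] the output law of the optimal input [P], with [K] atoms
    [x_i], and [q] the output law of the arcsine input. Write [D(x|V)] for the relative entropy
    of [W_x] from [V].

    The Kuhn-Tucker conditions say that [D(x|Q) <= C] for all [x], with equality at the atoms.
    Averaging the inequality over the arcsine law and the equality over [P], the capacity
    cancels and the symmetrised divergence of [q] and [Q] is at most the difference of the two
    averages of [D(x|q)]. That function is constant up to [4 E_x(1/(Y+1) + 1/(n-Y+1))], where
    [E_x] is the expectation of [Y] under [W_x]. The log-convexity of [Q(y)/C(n,y)] in [y] and
    the equality at the atoms give [Q(y) <= 2 e^-C max_x W_x(y)], so that [Q] is at most a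
    constant multiple of [q]; hence the chi-square divergence of [Q] from [q] is
    [O(log n / sqrt n)].

    On the other hand, with [x = sin^2 u], the kernel [sum_y W_x(y) W_x'(y) / q(y)] is a cosine
    series in [u] and [u'] with coefficients [C(2n,n+l)/C(2n,n)], so the chi-square divergence is
    the sum of the squared cosine moments of [P] with these weights. By positivity of the Fejer
    kernel, the squared moments of order between [1] and [4K] of a law with [K] atoms cannot be
    small on average, which bounds the divergence below by [exp(-64 K^2/n)]. If
    [K < (1/8) sqrt (n L)] with [L] the iterated logarithm of the theorem, this is at least
    [e^-L], of order [1 / log n]: a contradiction. The bound [e^C <= K] follows from
    [p_i <= e^-C], and [2 <= e^C] from the Kuhn-Tucker conditions at [0] and [1]. *)

Require Import Defs.
From HB Require Import structures.
From mathcomp Require Import all_boot all_order all_algebra.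
From mathcomp Require Import all_classical all_reals all_analysis.
From mathcomp Require Import measurable_realfun.
From mathcomp Require Import ring lra.
Import Order.TTheory GRing.Theory Num.Theory.
Import numFieldNormedType.Exports.
Local Open Scope classical_set_scope.
Local Open Scope ring_scope.

(** * Expectations under the binomial law *)

Definition binE {R : realType} (n : nat) (x : R) (g : nat -> R) : R :=
  \sum_(y < n.+1) binW n y x * g y.

Lemma binW_ge0 (R : realType) (n y : nat) (x : R) : 0 <= x <= 1 -> 0 <= binW n y x.
Proof.
move=> /andP[x0 x1]; rewrite /binW !mulr_ge0 ?exprn_ge0 ?ler0n //.
by rewrite subr_ge0.
Qed.

Lemma binW_out (R : realType) (n y : nat) (x : R) : (n < y)%N -> binW n y x = 0.
Proof. by move=> ny; rewrite /binW bin_small // !mul0r. Qed.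

Lemma sum_binW (R : realType) (n : nat) (x : R) : \sum_(y < n.+1) binW n y x = 1.
Proof.
have := exprDn (1 - x) x n; rewrite subrK expr1n => ->.
by apply: eq_bigr => y _; rewrite /binW -mulr_natl; ring.
Qed.

Lemma eq_binE (R : realType) (n : nat) (x : R) (g h : nat -> R) :
  (forall y, (y <= n)%N -> g y = h y) -> binE n x g = binE n x h.
Proof. by move=> gh; apply: eq_bigr => y _; rewrite gh // -ltnS. Qed.

Lemma binE_cst (R : realType) (n : nat) (x c : R) : binE n x (fun=> c) = c.
Proof. by rewrite /binE -mulr_suml sum_binW mul1r. Qed.

Lemma binED (R : realType) (n : nat) (x : R) (g h : nat -> R) :
  binE n x (fun y => g y + h y) = binE n x g + binE n x h.
Proof. by rewrite /binE -big_split; apply: eq_bigr => y _; rewrite mulrDr. Qed.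

Lemma binEZ (R : realType) (n : nat) (x c : R) (g : nat -> R) :
  binE n x (fun y => c * g y) = c * binE n x g.
Proof. by rewrite /binE mulr_sumr; apply: eq_bigr => y _; rewrite mulrCA. Qed.

Lemma ler_binE (R : realType) (n : nat) (x : R) (g h : nat -> R) : 0 <= x <= 1 ->
  (forall y, (y <= n)%N -> g y <= h y) -> binE n x g <= binE n x h.
Proof.
by move=> x01 gh; apply: ler_sum => y _; rewrite ler_wpM2l ?binW_ge0 ?gh // -ltnS.
Qed.

Lemma binWS (R : realType) (n y : nat) (x : R) :
  binW n.+1 y.+1 x = x * binW n y x + (1 - x) * binW n y.+1 x.
Proof.
rewrite /binW binS natrD subSS exprS.
have [yn|ny] := ltnP y n; last by rewrite (@bin_small n y.+1) //; ring.
by rewrite -(subnSK yn) !exprS; ring.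
Qed.

(** Condition on one of the [n.+1] trials; the central moments follow by induction on [n] from this
    recursion. *)
Lemma binES (R : realType) (n : nat) (x : R) (g : nat -> R) :
  binE n.+1 x g = x * binE n x (fun y => g y.+1) + (1 - x) * binE n x g.
Proof.
rewrite /binE big_ord_recl [X in _ + _ * X]big_ord_recl /=.
rewrite (eq_bigr (fun i : 'I_n.+1 => x * (binW n i x * g i.+1)
  + (1 - x) * (binW n i.+1 x * g i.+1))); last first.
  by move=> i _; rewrite /bump leq0n add1n binWS; ring.
rewrite big_split /= -!mulr_sumr [X in _ + (_ + _ * X)]big_ord_recr /=.
rewrite (@binW_out _ n n.+1) // mul0r addr0.
have W0 m : binW m 0 x = (1 - x) ^+ m by rewrite /binW bin0 subn0 expr0 !mul1r.
by rewrite !W0 exprS; ring.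
Qed.

Lemma binE_central_moments (R : realType) (n : nat) (x : R) :
  let N := n%:R in let v := x * (1 - x) in
  [/\ binE n x (fun y => y%:R - N * x) = 0,
      binE n x (fun y => (y%:R - N * x) ^+ 2) = N * v,
      binE n x (fun y => (y%:R - N * x) ^+ 3) = N * v * (1 - 2 * x) &
      binE n x (fun y => (y%:R - N * x) ^+ 4) = 3 * (N * v) ^+ 2 + N * v * (1 - 6 * v)].
Proof.
elim: n => [|n [m1 m2 m3 m4]] /=.
  rewrite /binE !big_ord1 /binW bin0 subnn !expr0 /= !mul1r mul0r subr0.
  by rewrite !expr0n /=; split; ring.
set N := n%:R in m1 m2 m3 m4; rewrite -natr1 -/N.
have M (k : nat) c : binE n x (fun y => (y%:R - (N + 1) * x + c) ^+ k) =
    binE n x (fun y => ((y%:R - N * x) + (c - x)) ^+ k).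
  by apply: eq_binE => y _; congr (_ ^+ _); ring.
pose E1 := fun c (y : nat) => (y%:R - N * x) + c.
have e1 c : binE n x (fun y => (y%:R - N * x) + c) = c by rewrite binED binE_cst m1 add0r.
have e2 c : binE n x (fun y => ((y%:R - N * x) + c) ^+ 2) = N * (x * (1 - x)) + c ^+ 2.
  rewrite (@eq_binE _ _ _ _ (fun y => (y%:R - N * x) ^+ 2 +
      ((2 * c) * (y%:R - N * x) + c ^+ 2))); last by move=> y _; ring.
  by rewrite !binED binEZ binE_cst m1 m2; ring.
have e3 c : binE n x (fun y => ((y%:R - N * x) + c) ^+ 3) =
    N * (x * (1 - x)) * (1 - 2 * x) + 3 * c * (N * (x * (1 - x))) + c ^+ 3.
  rewrite (@eq_binE _ _ _ _ (fun y => (y%:R - N * x) ^+ 3 + ((3 * c) * (y%:R - N * x) ^+ 2 +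
      ((3 * c ^+ 2) * (y%:R - N * x) + c ^+ 3)))); last by move=> y _; ring.
  by rewrite !binED !binEZ binE_cst m1 m2 m3; ring.
have e4 c : binE n x (fun y => ((y%:R - N * x) + c) ^+ 4) =
    3 * (N * (x * (1 - x))) ^+ 2 + N * (x * (1 - x)) * (1 - 6 * (x * (1 - x)))
    + 4 * c * (N * (x * (1 - x)) * (1 - 2 * x)) + 6 * c ^+ 2 * (N * (x * (1 - x))) + c ^+ 4.
  rewrite (@eq_binE _ _ _ _ (fun y => (y%:R - N * x) ^+ 4 + ((4 * c) * (y%:R - N * x) ^+ 3 +
      ((6 * c ^+ 2) * (y%:R - N * x) ^+ 2 +
      ((4 * c ^+ 3) * (y%:R - N * x) + c ^+ 4))))); last by move=> y _; ring.
  by rewrite !binED !binEZ binE_cst m1 m2 m3 m4; ring.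
(* A success moves the centred count by [1 - x], a failure by [- x]. *)
have S1 k : binE n x (fun y => (y.+1%:R - (N + 1) * x) ^+ k) =
    binE n x (fun y => (y%:R - N * x + (1 - x)) ^+ k).
  by apply: eq_binE => y _; rewrite -natr1; congr (_ ^+ _); ring.
have S0 k : binE n x (fun y => (y%:R - (N + 1) * x) ^+ k) =
    binE n x (fun y => (y%:R - N * x + (- x)) ^+ k).
  by apply: eq_binE => y _; congr (_ ^+ _); ring.
split; rewrite binES.
- rewrite (@eq_binE _ _ _ (fun y => y.+1%:R - _) (fun y => y%:R - N * x + (1 - x))).
    rewrite (@eq_binE _ _ _ (fun y => y%:R - _) (fun y => y%:R - N * x + (- x))).
      by rewrite !e1; ring.
    by move=> y _; ring.
  by move=> y _; rewrite -natr1; ring.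
- by rewrite S1 S0 !e2; ring.
- by rewrite S1 S0 !e3; ring.
- by rewrite S1 S0 !e4; ring.
Qed.

(** * Taylor bounds on the logarithm *)

Lemma ge0_derive_sign1 (R : realType) (f df : R -> R) :
  (forall x : R, 0 < x -> is_derive x 1 f (df x)) ->
  (forall x : R, 0 < x -> 0 <= df x * (x - 1)) -> f 1 = 0 ->
  forall t : R, 0 < t -> 0 <= f t.
Proof.
move=> fdf sdf f1 t t0.
have cf (a b : R) : 0 < a -> {within `[a, b], continuous f}.
  move=> a0; apply: derivable_within_continuous => x; rewrite in_itv /= => /andP[ax _].
  by have [] := fdf x (lt_le_trans a0 ax).
have mvt (a b : R) : 0 < a -> a < b -> exists2 c, a < c < b & f b - f a = df c * (b - a).
  move=> a0 ab; have fd (x : R) : x \in `]a, b[ -> is_derive x 1 f (df x).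
    by rewrite in_itv /= => /andP[ax _]; apply: fdf; apply: lt_trans ax.
  by have [c] := @MVT R f df a b ab fd (cf a b a0); exists c.
case: (ltgtP t 1) => [t1|t1|->]; last by rewrite f1.
- have [c] := mvt _ _ t0 t1; rewrite f1 => /andP[tc c1] e; have := sdf c (lt_trans t0 tc).
  have c10 : c - 1 < 0 by rewrite subr_lt0.
  have t10 : 0 < 1 - t by rewrite subr_gt0.
  rewrite nmulr_lge0 // => dc; rewrite -oppr_le0 -[- f t]add0r e.
  by rewrite mulr_le0_ge0 // ltW.
- have [c] := mvt _ _ ltr01 t1; rewrite f1 subr0 => /andP[tc c1] ->; have := sdf c (lt_trans ltr01 tc).
  have c10 : 0 < c - 1 by rewrite subr_gt0.
  by rewrite pmulr_lge0 // => dc; rewrite mulr_ge0 // subr_ge0 ltW.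
Qed.

(** The cubic is the Taylor polynomial of [ln] at 1. Its difference with [ln] has derivative
    [(t - 1)^3 / t], of the sign of [t - 1], so the minimum is at 1. *)
Lemma ln_le_taylor3 (R : realType) (t : R) : 0 < t ->
  ln t <= t ^+ 3 / 3 - 3 / 2 * t ^+ 2 + 3 * t - 11 / 6.
Proof.
move=> t0; rewrite -subr_ge0.
pose p : {poly R} := 3^-1 *: 'X^3 - (3 / 2) *: 'X^2 + 3 *: 'X - (11 / 6)%:P.
have pE x : p.[x] = x ^+ 3 / 3 - 3 / 2 * x ^+ 2 + 3 * x - 11 / 6.
  by rewrite /p !(hornerD, hornerN, hornerZ, hornerXn, hornerX, hornerC); field.
rewrite -pE; apply: (@ge0_derive_sign1 _ (fun x => p.[x] - ln x)
  (fun x => (x - 1) ^+ 3 / x)) => // {t t0}.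
- move=> x x0; have xn := lt0r_neq0 x0.
  apply: (@is_derive_eq _ _ _ _ _ _ _ _ (is_deriveB (is_derive_poly p x) (is_derive1_ln x0))).
  by rewrite /p !(derivB, derivD, derivZ, derivXn, derivX, derivC)
    !(hornerD, hornerN, hornerZ, hornerMn, hornerXn, hornerX, hornerC) /=; field.
- move=> x x0; rewrite mulrAC -exprSr divr_ge0 ?(ltW x0) //.
  by rewrite (_ : 4 = 2 * 2)%N // exprM sqr_ge0.
- by rewrite pE ln1; field.
Qed.

(** The lower bound is chosen so that its product with [t] is the cubic Taylor polynomial of
    [t * ln t] at 1. *)
Lemma ln_ge_taylor3 (R : realType) (t : R) : 0 < t ->
  - t ^+ 2 / 6 + t - 1 / 2 - (3 * t)^-1 <= ln t.
Proof.
move=> t0; rewrite -subr_ge0.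
pose p : {poly R} := 6^-1 *: 'X^2 - 'X + (1 / 2)%:P.
have pE x : p.[x] = x ^+ 2 / 6 - x + 1 / 2.
  by rewrite /p !(hornerD, hornerN, hornerZ, hornerXn, hornerX, hornerC); field.
suff : 0 <= ln t + p.[t] + 3^-1 * t^-1 by rewrite pE invfM => ?; lra.
apply: (@ge0_derive_sign1 _ (fun x => ln x + p.[x] + 3^-1 * x^-1)
  (fun x => (x - 1) ^+ 3 / (3 * x ^+ 2))) => // {t t0}.
- move=> x x0; have xn := lt0r_neq0 x0.
  apply: (@is_derive_eq _ _ _ _ _ _ _ _
    (is_deriveD (is_deriveD (is_derive1_ln x0) (is_derive_poly p x))
      (is_deriveZ 3^-1 (is_deriveV xn (is_derive_id x 1))))).
  by rewrite /p !(derivB, derivD, derivZ, derivXn, derivX, derivC)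
    !(hornerD, hornerN, hornerZ, hornerMn, hornerXn, hornerX, hornerC) /GRing.scale /=; field.
- move=> x x0; rewrite mulrAC -exprSr; apply: divr_ge0.
    by rewrite (_ : 4 = 2 * 2)%N // exprM sqr_ge0.
  by rewrite mulr_ge0 ?sqr_ge0.
- by rewrite ln1 pE; field.
Qed.

Lemma ln_le_sub1 (R : realType) (t : R) : 0 < t -> ln t <= t - 1.
Proof. by move=> t0; have := @le_ln1Dx R (t - 1); rewrite subrKC; apply; lra. Qed.

Lemma ln_ge_1subV (R : realType) (t : R) : 0 < t -> 1 - t^-1 <= ln t.
Proof.
move=> t0; have := @ln_le_sub1 R t^-1; rewrite invr_gt0 lnV ?posrE // => /(_ t0); lra.
Qed.

(** * The divergence of the empirical type *)

(** With [u = m * t], the bounds on [ln t] are multiplied by [t], which allows [u = 0]. The last two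
    bounds differ by a quartic term only, so four central moments will control the expectation. *)
Lemma xln_div_bounds (R : realType) (m u : R) : 0 < m -> 0 <= u ->
  let d := u - m in
  [/\ d <= u * ln (u / m),
      u * ln (u / m) <= d + d ^+ 2 / m,
      d + d ^+ 2 / (2 * m) - d ^+ 3 / (6 * m ^+ 2) <= u * ln (u / m) &
      u * ln (u / m) <= d + d ^+ 2 / (2 * m) - d ^+ 3 / (6 * m ^+ 2) + d ^+ 4 / (3 * m ^+ 3)].
Proof.
move=> m0 u0 d; have mn := lt0r_neq0 m0.
pose t := u / m; have -> : d = m * (t - 1) by rewrite /t /d; field.
have -> : u * ln (u / m) = m * (t * ln t) by rewrite /t mulrA [m * _]mulrC divfK.
have t0 : 0 <= t by rewrite divr_ge0 // ltW.
have -> : m * (t - 1) + (m * (t - 1)) ^+ 2 / m = m * (t * (t - 1)) by field.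
have -> : m * (t - 1) + (m * (t - 1)) ^+ 2 / (2 * m) - (m * (t - 1)) ^+ 3 / (6 * m ^+ 2)
  + (m * (t - 1)) ^+ 4 / (3 * m ^+ 3) =
  m * (t * (t ^+ 3 / 3 - 3 / 2 * t ^+ 2 + 3 * t - 11 / 6)) by field.
have -> : m * (t - 1) + (m * (t - 1)) ^+ 2 / (2 * m) - (m * (t - 1)) ^+ 3 / (6 * m ^+ 2) =
  m * (t * (- t ^+ 2 / 6 + t - 1 / 2) - 1 / 3) by field.
rewrite !(ler_pM2l m0); clearbody t.
move: t0; rewrite le_eqVlt => /predU1P[<-|t0].
  by split; rewrite ?mul0r; lra.
have tn := lt0r_neq0 t0.
split.
- by have := ler_wpM2l (ltW t0) (ln_ge_1subV _ _ t0); rewrite mulrBr mulfV // mulr1.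
- by rewrite ler_pM2l // ln_le_sub1.
- have := ler_wpM2l (ltW t0) (ln_ge_taylor3 _ _ t0); apply: le_trans.
  by rewrite le_eqVlt; apply/orP; left; apply/eqP; field.
- by rewrite ler_pM2l // ln_le_taylor3.
Qed.

(* [n] times the binary relative entropy between [y / n] and [x] *)
Definition type_div {R : realType} (n : nat) (x : R) (y : nat) : R :=
  y%:R * ln (y%:R / (n%:R * x)) + (n - y)%:R * ln ((n - y)%:R / (n%:R * (1 - x))).

(** The common scale of all error terms: of order one only when [y] or [n - y] is bounded. *)
Definition edge_wt {R : realType} (n y : nat) : R := y.+1%:R^-1 + (n - y).+1%:R^-1.

Lemma edge_wt_ge0 (R : realType) (n y : nat) : 0 <= edge_wt n y :> R.
Proof. by rewrite addr_ge0 // invr_ge0 ler0n. Qed.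

Lemma edge_wt_le2 (R : realType) (n y : nat) : edge_wt n y <= 2 :> R.
Proof.
have h k : k.+1%:R^-1 <= 1 :> R by rewrite invf_le1 ?ltr0n // ler1n.
exact: (lerD (h y) (h (n - y)%N)).
Qed.

Lemma binE_mean (R : realType) (n : nat) (x : R) : binE n x (fun y => y%:R) = n%:R * x.
Proof.
have [m1 _ _ _] := @binE_central_moments R n x; move: m1.
by rewrite binED binE_cst => /eqP; rewrite subr_eq0 => /eqP.
Qed.

Lemma inv_ge_tangent (R : realType) (a u : R) : 0 < a -> 0 < u -> 2 / a - u / a ^+ 2 <= u^-1.
Proof.
move=> a0 u0; have an := lt0r_neq0 a0; have un := lt0r_neq0 u0.
rewrite -subr_ge0 (_ : _ - _ = (u - a) ^+ 2 / (a ^+ 2 * u)); last by field; rewrite an un.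
apply: divr_ge0; first exact: sqr_ge0.
by apply: mulr_ge0; [exact: sqr_ge0|exact: ltW].
Qed.

(** Jensen's inequality for the inverse, by its tangent at the mean, so that only the first moment
    enters. *)
Lemma binE_edge_wt_ge (R : realType) (n : nat) (x : R) : 0 <= x <= 1 ->
  (n%:R * x + 1)^-1 + (n%:R * (1 - x) + 1)^-1 <= binE n x (edge_wt n).
Proof.
move=> x01; have /andP[x0 x1] := x01.
have nx0 : 0 < n%:R * x + 1 by rewrite ltr_wpDl // mulr_ge0.
have nx1 : 0 < n%:R * (1 - x) + 1 by rewrite ltr_wpDl // mulr_ge0 // subr_ge0.
rewrite binED; apply: lerD.
- apply: le_trans (_ : binE n x (fun y => 2 / (n%:R * x + 1) - y.+1%:R / (n%:R * x + 1) ^+ 2) <= _).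
    rewrite (@eq_binE _ _ _ _ (fun y => - ((n%:R * x + 1) ^+ 2)^-1 * y%:R +
        (2 / (n%:R * x + 1) - ((n%:R * x + 1) ^+ 2)^-1))); last first.
      by move=> y _; rewrite -natr1; ring.
    rewrite binED binEZ binE_cst binE_mean le_eqVlt; apply/orP; left; apply/eqP.
    by field; exact: lt0r_neq0.
  by apply: ler_binE => // y _; exact: inv_ge_tangent.
- apply: le_trans (_ : binE n x (fun y => 2 / (n%:R * (1 - x) + 1) -
      (n - y).+1%:R / (n%:R * (1 - x) + 1) ^+ 2) <= _).
    rewrite (@eq_binE _ _ _ _ (fun y => ((n%:R * (1 - x) + 1) ^+ 2)^-1 * y%:R +
        (2 / (n%:R * (1 - x) + 1) - (n%:R + 1) / ((n%:R * (1 - x) + 1) ^+ 2)))); last first.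
      by move=> y yn; rewrite -[(n - y).+1%:R]natr1 natrB //; ring.
    rewrite binED binEZ binE_cst binE_mean le_eqVlt; apply/orP; left; apply/eqP.
    by field; exact: lt0r_neq0.
  by apply: ler_binE => // y _; exact: inv_ge_tangent.
Qed.

Lemma inv_le_2inv1 (R : realType) (a : R) : 1 <= a -> a^-1 <= 2 * (a + 1)^-1.
Proof.
move=> a1; have a0 : 0 < a by lra.
rewrite -[leLHS]div1r ler_pdivrMr // mulrAC ler_pdivlMr; lra.
Qed.

(** The second-order Taylor term has mean exactly [1 / 2], and the terms of order three and four
    have means of order [1 / (n x) + 1 / (n (1 - x))]. By [binE_edge_wt_ge] this is controlled by
    the mean of [edge_wt]. *)
Lemma binE_type_div (R : realType) (n : nat) (x : R) : (0 < n)%N -> 0 <= x <= 1 ->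
  `|binE n x (type_div n x) - 1 / 2| <= 3 * binE n x (edge_wt n).
Proof.
move=> n0 x01; have := binE_edge_wt_ge _ n _ x01.
set W := binE n x (edge_wt n); move=> Wge.
suff : `|binE n x (type_div n x) - 1 / 2| <=
    3 * ((n%:R * x + 1)^-1 + (n%:R * (1 - x) + 1)^-1).
  by move=> h; apply: (le_trans h); rewrite ler_pM2l.
clear W Wge; have n0' : 0 < n%:R :> R by rewrite ltr0n.
have /andP[x0 x1] := x01; rewrite ler_norml.
(* For [x = 0] or [x = 1] the law is a point mass at an output where [type_div] vanishes. *)
have edge y : x = 0 \/ x = 1 -> (y <= n)%N -> binW n y x * type_div n x y = 0.
  case=> ->; rewrite /binW /type_div.
    case: y => [|y] _; last by rewrite expr0n /= !(mul0r, mulr0).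
    by rewrite !mul0r subr0 subn0 mulr1 mulfV ?ln1 ?mulr0 ?addr0 ?mulr0 // lt0r_neq0.
  rewrite leq_eqVlt => /predU1P[->|yn]; last first.
    by rewrite subrr expr0n subn_eq0 leqNgt yn /= !(mul0r, mulr0).
  by rewrite subnn mul0r mulr1 mulfV ?ln1 ?mulr0 ?addr0 ?mulr0 // lt0r_neq0.
have crude (a : R) : 0 <= a -> 0 <= (a + 1)^-1 by move=> ?; rewrite invr_ge0; lra.
have crude' (a : R) : 0 <= a -> a <= 1 -> 2^-1 <= (a + 1)^-1.
  by move=> ? ?; rewrite lef_pV2 ?posrE; lra.
have m0 : 0 <= n%:R * x by rewrite mulr_ge0.
have m0' : 0 <= n%:R * (1 - x) by rewrite mulr_ge0 // subr_ge0.
have [xb|xi] := boolP ((x == 0) || (x == 1)).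
  have xb' : x = 0 \/ x = 1 by case/orP: xb => /eqP; [left|right].
  rewrite /binE big1; last by move=> y _; rewrite edge // -ltnS.
  have := crude _ m0; have := crude _ m0'.
  have : 2^-1 <= (n%:R * x + 1)^-1 \/ 2^-1 <= (n%:R * (1 - x) + 1)^-1.
    by case: xb' => ->; [left|right]; apply: crude' => //; rewrite ?subrr mulr0.
  by case; lra.
have [x0' x1'] : 0 < x /\ x < 1.
  rewrite negb_or in xi; case/andP: xi => ? ?.
  by rewrite !lt_def x0 x1 eq_sym; split; rewrite // andbT eq_sym.
pose m := n%:R * x; pose m' := n%:R * (1 - x).
have mp : 0 < m by rewrite mulr_gt0.
have mp' : 0 < m' by rewrite mulr_gt0 // subr_gt0.
have [m1 m2 m3 m4] := @binE_central_moments R n x; rewrite -/m in m1 m2 m3 m4.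
have bd y : (y <= n)%N -> let d := y%:R - m in [/\ 0 <= type_div n x y,
   type_div n x y <= (m^-1 + m'^-1) * d ^+ 2,
   (m^-1 + m'^-1) / 2 * d ^+ 2 + (- (m ^- 2 - m' ^- 2) / 6) * d ^+ 3 <= type_div n x y &
   type_div n x y <= (m^-1 + m'^-1) / 2 * d ^+ 2 + (- (m ^- 2 - m' ^- 2) / 6) * d ^+ 3
     + (m ^- 3 + m' ^- 3) / 3 * d ^+ 4].
  move=> yn d; have [a1 a2 a3 a4] := xln_div_bounds _ _ _ mp (ler0n R y).
  have [] := xln_div_bounds _ _ _ mp' (ler0n R (n - y)).
  have -> : (n - y)%:R - m' = - d by rewrite natrB // /m' /d /m; ring.
  rewrite -/d in a1 a2 a3 a4; move=> b1 b2 b3 b4; rewrite /type_div -/m -/m'; split.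
  - lra.
  - apply: le_trans (lerD a2 b2) _; rewrite le_eqVlt; apply/orP; left; apply/eqP; field.
    by rewrite !lt0r_neq0.
  - apply: le_trans (lerD a3 b3); rewrite le_eqVlt; apply/orP; left; apply/eqP; field.
    by rewrite !lt0r_neq0.
  - apply: le_trans (lerD a4 b4) _; rewrite le_eqVlt; apply/orP; left; apply/eqP; field.
    by rewrite !lt0r_neq0.
have nn := lt0r_neq0 n0'; have xn := lt0r_neq0 x0'.
have xn' : 1 - x != 0 by rewrite subr_eq0 eq_sym; lra.
have sig : (m^-1 + m'^-1) * (n%:R * (x * (1 - x))) = 1.
  by rewrite /m /m'; field; rewrite nn xn xn'.
have e0 : 0 <= binE n x (type_div n x).
  rewrite -[leLHS](binE_cst _ n x); apply: ler_binE => // y yn.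
  by have [] := bd y yn.
have e1 : binE n x (type_div n x) <= 1.
  rewrite -sig -m2 -binEZ; apply: ler_binE => // y yn; by have [] := bd y yn.
(* When the mean number of successes or of failures is at most 1, the error bound is at least
   [3 / 2] and the crude bounds [0] and [1] on the expectation suffice. *)
have [mle|mgt] := leP m 1.
  by have := crude' _ (ltW mp) mle; have := crude _ m0'; rewrite -/m -/m'; lra.
have [mle'|mgt'] := leP m' 1.
  by have := crude' _ (ltW mp') mle'; have := crude _ m0; rewrite -/m -/m'; lra.
have := inv_le_2inv1 _ _ (ltW mgt); have := inv_le_2inv1 _ _ (ltW mgt').
move=> im' im; have := crude _ m0; have := crude _ m0'; rewrite -/m -/m' => i0' i0.
set e := binE n x (type_div n x) in e0 e1 *; apply/andP; split.
- have : binE n x (fun y => (m^-1 + m'^-1) / 2 * (y%:R - m) ^+ 2 +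
      (- (m ^- 2 - m' ^- 2) / 6) * (y%:R - m) ^+ 3) <= e.
    by apply: ler_binE => // y yn; have [] := bd y yn.
  rewrite binED !binEZ m2 m3 mulrAC sig.
  have -> : - (m ^- 2 - m' ^- 2) / 6 * (n%:R * (x * (1 - x)) * (1 - 2 * x)) =
      - (m^-1 + m'^-1) / 6 + 2 / 3 / n%:R.
    by rewrite /m /m'; field; rewrite nn xn xn'.
  have : 0 <= n%:R^-1 :> R by rewrite invr_ge0.
  lra.
- have : e <= binE n x (fun y => (m^-1 + m'^-1) / 2 * (y%:R - m) ^+ 2 +
      (- (m ^- 2 - m' ^- 2) / 6) * (y%:R - m) ^+ 3 + (m ^- 3 + m' ^- 3) / 3 * (y%:R - m) ^+ 4).
    by apply: ler_binE => // y yn; have [] := bd y yn.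
  rewrite !binED !binEZ m2 m3 m4 mulrAC sig.
  have -> : - (m ^- 2 - m' ^- 2) / 6 * (n%:R * (x * (1 - x)) * (1 - 2 * x)) =
      - (1 - 2 * x) ^+ 2 / (6 * (n%:R * (x * (1 - x)))).
    by rewrite /m /m'; field; rewrite nn xn xn'.
  have s0 : 0 < n%:R * (x * (1 - x)) by rewrite !mulr_gt0 // subr_gt0.
  have : 0 <= (1 - 2 * x) ^+ 2 / (6 * (n%:R * (x * (1 - x)))).
    by rewrite divr_ge0 ?sqr_ge0 // mulr_ge0 // ltW.
  rewrite mulNr; set u := (1 - 2 * x) ^+ 2 / _ => u0.
  have mi : m^-1 <= 1 by rewrite invf_le1 // ltW.
  have mi' : m'^-1 <= 1 by rewrite invf_le1 // ltW.
  have mi0 : 0 <= m^-1 by rewrite invr_ge0 ltW.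
  have mi0' : 0 <= m'^-1 by rewrite invr_ge0 ltW.
  set s := n%:R * (x * (1 - x)) in s0 *.
  have sm : s / m <= 1.
    by rewrite /s /m (_ : _ / _ = 1 - x) ?gerBl //; field; rewrite nn xn.
  have sm' : s / m' <= 1.
    by rewrite /s /m' (_ : _ / _ = x) //; field; rewrite nn xn'.
  (* Applied with [a = 1 / m] and [a = 1 / m']: the fourth central moment is at most [3 s^2 + s],
     and each factor [s * a] is at most 1. *)
  have four a : 0 <= a -> a <= 1 -> s * a <= 1 ->
      a ^+ 3 * (3 * s ^+ 2 + s * (1 - 6 * (x * (1 - x)))) <= 4 * a.
    move=> a0 a1 sa.
    apply: le_trans (_ : a ^+ 3 * (3 * s ^+ 2 + s) <= _).
      rewrite ler_wpM2l ?exprn_ge0 // lerD2l ler_piMr ?(ltW s0) //.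
      by rewrite gerBl mulr_ge0 // mulr_ge0 // subr_ge0.
    have sa0 : 0 <= s * a by rewrite mulr_ge0 // ltW.
    have h1 : (s * a) ^+ 2 <= 1 by rewrite expr_le1.
    have h2 : a * (s * a) <= 1 by rewrite mulr_ile1.
    rewrite (_ : _ * _ = a * (3 * (s * a) ^+ 2 + a * (s * a))); last by ring.
    by rewrite mulrC ler_wpM2r //; lra.
  have := four _ mi0 mi sm; have := four _ mi0' mi' sm'.
  rewrite !exprVn; lra.
Qed.

(** * The arcsine output law *)

(** The Taylor coefficients of [(1 - z)^(-1/2)], asymptotic to [1 / sqrt (pi * y)]. *)
Definition arcsin_wt {R : realType} (y : nat) : R := 'C(y.*2, y)%:R / 4 ^+ y.

(* The output law of the arcsine input, in closed form; see [arcsin_out_node]. *)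
Definition arcsin_out {R : realType} (n y : nat) : R := arcsin_wt y * arcsin_wt (n - y).

(* [max_x binW n y x], attained at [x = y / n]; [0 ^+ 0 = 1] covers [y = 0] and [y = n]. *)
Definition max_lik {R : realType} (n y : nat) : R :=
  'C(n, y)%:R * (y%:R ^+ y * (n - y)%:R ^+ (n - y)) / n%:R ^+ n.

(* Tends to [- ln 2 / 2]; only the speed of convergence is used, not the limit. *)
Definition stirling_gap {R : realType} (y : nat) : R :=
  y%:R * ln (4 * y%:R) + ln y`!%:R - ln (y.*2)`!%:R - y%:R.

(** The value of [ln (max_lik n y / arcsin_out n y)] with both Stirling gaps frozen at [n]. The
    divergence from the arcsine output law stays close to [red_cst n - 1 / 2]. *)
Definition red_cst {R : realType} (n : nat) : R :=
  ln n`!%:R - n%:R * ln n%:R + n%:R + 2 * stirling_gap n.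

Lemma arcsin_wt_gt0 (R : realType) (y : nat) : 0 < arcsin_wt y :> R.
Proof. by rewrite divr_gt0 ?exprn_gt0 // ltr0n bin_gt0 -addnn leq_addr. Qed.

Lemma arcsin_out_gt0 (R : realType) (n y : nat) : 0 < arcsin_out n y :> R.
Proof. by rewrite mulr_gt0 ?arcsin_wt_gt0. Qed.

Lemma natX_gt0 (R : realType) (y : nat) : 0 < y%:R ^+ y :> R.
Proof. by case: y => [|y]; rewrite ?expr0 // exprn_gt0 // ltr0n. Qed.

Lemma max_lik_gt0 (R : realType) (n y : nat) : (y <= n)%N -> 0 < max_lik n y :> R.
Proof. by move=> yn; rewrite !(divr_gt0, mulr_gt0) ?natX_gt0 // ltr0n bin_gt0. Qed.

Lemma ln_natX (R : realType) (y : nat) : ln (y%:R ^+ y) = y%:R * ln y%:R :> R.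
Proof.
case: y => [|y]; first by rewrite expr0 ln1 mul0r.
by rewrite lnXn ?ltr0n // mulr_natl.
Qed.

Lemma ln_fact_gt0 (R : realType) (y : nat) : y`!%:R \is @Num.pos R.
Proof. by rewrite posrE ltr0n fact_gt0. Qed.

Lemma ln_arcsin_wt (R : realType) (y : nat) :
  ln (arcsin_wt y) = ln (y.*2)`!%:R - 2 * ln y`!%:R - y%:R * ln 4 :> R.
Proof.
have yy : (y <= y.*2)%N by rewrite -addnn leq_addr.
have <- : ln 'C(y.*2, y)%:R + (ln y`!%:R + ln y`!%:R) = ln (y.*2)`!%:R :> R.
  rewrite -!lnM ?posrE ?mulr_gt0 ?ltr0n ?fact_gt0 ?bin_gt0 //.
  by rewrite -!natrM -(bin_fact yy) -addnn addnK.
rewrite /arcsin_wt ln_div ?posrE ?exprn_gt0 ?ltr0n ?bin_gt0 // lnXn // mulr_natl; ring.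
Qed.

(** The factorials and powers separate into a part in [y] and the same part in [n - y]; since
    [stirling_gap] converges, the ratio is nearly constant away from the ends. *)
Lemma ln_max_lik_arcsin_out (R : realType) (n y : nat) : (y <= n)%N ->
  ln (max_lik n y / arcsin_out n y) =
  ln n`!%:R - n%:R * ln n%:R + n%:R + stirling_gap y + stirling_gap (n - y) :> R.
Proof.
move=> yn; have <- : ln 'C(n, y)%:R + (ln y`!%:R + ln (n - y)`!%:R) = ln n`!%:R :> R.
  rewrite -!lnM ?posrE ?mulr_gt0 ?ltr0n ?fact_gt0 ?bin_gt0 //.
  by rewrite -!natrM bin_fact.
have p1 := natX_gt0 R y; have p2 := natX_gt0 R (n - y); have p3 := natX_gt0 R n.
have p4 := arcsin_wt_gt0 R y; have p5 := arcsin_wt_gt0 R (n - y).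
have p6 : 0 < 'C(n, y)%:R :> R by rewrite ltr0n bin_gt0.
rewrite ln_div ?posrE ?max_lik_gt0 ?arcsin_out_gt0 // /max_lik /arcsin_out ln_div ?posrE ?mulr_gt0 //.
rewrite [ln (arcsin_wt y * _)]lnM ?posrE // !ln_arcsin_wt !lnM ?posrE ?mulr_gt0 // !ln_natX.
have l4 (k : nat) : k%:R * ln (4 * k%:R) = k%:R * (ln 4 + ln k%:R) :> R.
  by case: k => [|k]; rewrite ?mul0r // lnM ?posrE ?ltr0n.
by rewrite /stirling_gap !l4 natrB //; ring.
Qed.

(** The bound is the telescoping form of [1 / ((y + 1) (y + 2))], the true order of the
    increment. *)
Lemma stirling_gapS (R : realType) (y : nat) :
  `|stirling_gap y.+1 - stirling_gap y| <= y.+1%:R^-1 - y.+2%:R^-1 :> R.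
Proof.
have c0 : 0 < y%:R + 1 :> R by rewrite ltr_wpDl.
have c1 : 0 < 2 * y%:R + 1 :> R by rewrite ltr_wpDl // mulr_ge0.
have n4 : 4 = 2 * 2 :> R by rewrite -natrM.
(* In this form the terms [1 / (2 y)] and [- 1 / (2 y)] of the two logarithmic parts cancel. *)
have e1 : stirling_gap y.+1 - stirling_gap y =
    ln ((2 * y%:R + 2) / (2 * y%:R + 1)) + y%:R * ln ((y%:R + 1) / y%:R) - 1 :> R.
  rewrite /stirling_gap.
  have -> : ln ((2 * y%:R + 2) / (2 * y%:R + 1)) = ln 2 + ln (y%:R + 1) - ln (2 * y%:R + 1) :> R.
    by rewrite -lnM ?posrE // -ln_div ?posrE ?mulr_gt0 // mulrDr mulr1.
  have -> : y%:R * ln ((y%:R + 1) / y%:R) = y%:R * (ln (y%:R + 1) - ln y%:R) :> R.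
    by case: y {c0 c1} => [|y]; rewrite ?mul0r // ln_div ?posrE ?ltr0n // -natrD ltr0n addn1.
  have l4 (k : nat) : k%:R * ln (4 * k%:R) = k%:R * (ln 2 + ln 2 + ln k%:R) :> R.
    by case: k => [|k]; rewrite ?mul0r // lnM ?posrE ?ltr0n // n4 lnM ?posrE.
  have -> : ln y.+1`!%:R = ln (y%:R + 1) + ln y`!%:R :> R.
    by rewrite factS natrM -natr1 lnM ?ln_fact_gt0 // posrE.
  have -> : ln (y.+1.*2)`!%:R = ln 2 + ln (y%:R + 1) + ln (2 * y%:R + 1) + ln (y.*2)`!%:R :> R.
    rewrite doubleS !factS !natrM.
    have -> : y.*2.+2%:R = 2 * (y%:R + 1) :> R by rewrite -addn2 -muln2 natrD natrM; ring.
    have -> : y.*2.+1%:R = 2 * y%:R + 1 :> R by rewrite -addn1 -muln2 natrD natrM; ring.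
    by rewrite !lnM ?ln_fact_gt0 ?posrE ?mulr_gt0 ?ltr0n ?fact_gt0 //; ring.
  by rewrite !l4 -natr1; ring.
rewrite e1 {e1}.
have -> : y.+2%:R = y%:R + 2 :> R by rewrite -addn2 natrD.
rewrite -[y.+1%:R]natr1.
case: y c0 c1 => [|y] c0 c1.
  rewrite mul0r addr0 !mulr0 !add0r !divr1 invr1 ler_norml.
  have := ln_ge_1subV R 2 (ltr0n _ 2); have := ln_le_sub1 R 2 (ltr0n _ 2); lra.
set k := y.+1%:R in c0 c1 *; have k1 : 1 <= k by rewrite ler1n.
clearbody k.
have k0 : 0 < k by lra.
have kn := lt0r_neq0 k0; have cn0 := lt0r_neq0 c0; have cn1 := lt0r_neq0 c1.
have c2 : 0 < k + 2 by lra.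
have cn2 := lt0r_neq0 c2.
have cn3 : 2 * k + 2 != 0 by lra.
have h1 : (2 * k + 2)^-1 <= ln ((2 * k + 2) / (2 * k + 1)).
  have := ln_ge_1subV R ((2 * k + 2) / (2 * k + 1)); rewrite invf_div.
  have -> : 1 - (2 * k + 1) / (2 * k + 2) = (2 * k + 2)^-1 by field; rewrite ?cn3 ?cn1.
  by apply; rewrite divr_gt0 //; lra.
have h2 : ln ((2 * k + 2) / (2 * k + 1)) <= (2 * k + 1)^-1.
  have := ln_le_sub1 R ((2 * k + 2) / (2 * k + 1)).
  have -> : (2 * k + 2) / (2 * k + 1) - 1 = (2 * k + 1)^-1 by field.
  by apply; rewrite divr_gt0 //; lra.
(* The deviation is 1 here; multiplying by [k / (k + 1)] turns the bounds into bounds on [k * l]. *)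
have [_ _ h3 h4] := xln_div_bounds _ k (k + 1) k0 (ltW c0).
set l := ln ((k + 1) / k) in h3 h4 *.
rewrite (_ : k + 1 - k = 1) ?expr1n in h3 h4; last by ring.
have el : k / (k + 1) * ((k + 1) * l) = k * l by rewrite mulrA divfK.
have {}h3 : 1 - (2^-1 + (6 * k)^-1) / (k + 1) <= k * l.
  have := ler_wpM2l (ltW (divr_gt0 k0 c0)) h3; rewrite el; apply: le_trans.
  by rewrite le_eqVlt; apply/orP; left; apply/eqP; field; rewrite ?cn0 ?kn.
have {}h4 : k * l <= 1 - (2^-1 + (6 * k)^-1 - (3 * k ^+ 2)^-1) / (k + 1).
  have := ler_wpM2l (ltW (divr_gt0 k0 c0)) h4; rewrite el => h; apply: le_trans h _.
  by rewrite le_eqVlt; apply/orP; left; apply/eqP; field; rewrite ?cn0 ?kn ?cn1 ?cn2 ?cn3.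
have i1 : (3 * k ^+ 2)^-1 <= (3 * k)^-1.
  by rewrite lef_pV2 ?posrE ?mulr_gt0 ?exprn_gt0 // ler_pM2l // expr2 ler_peMl // ltW.
rewrite ler_norml; apply/andP; split.
- apply: le_trans (_ : (2 * k + 2)^-1 + (1 - (2^-1 + (6 * k)^-1) / (k + 1)) - 1 <= _); last by lra.
  rewrite -subr_ge0.
  rewrite (_ : _ - _ = (5 * k - 2) / (6 * k * (k + 1) * (k + 2))); last first.
    by field; rewrite ?cn0 ?kn ?cn1 ?cn2 ?cn3.
  by rewrite divr_ge0 ?mulr_ge0 //; lra.
- apply: le_trans (_ : (2 * k + 1)^-1 + (1 - (2^-1 + (6 * k)^-1 - (3 * k)^-1) / (k + 1)) - 1 <= _).
    rewrite lerB // lerD // (le_trans h4) // lerD2l lerN2 ler_wpM2r ?invr_ge0 ?(ltW c0) //.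
    by rewrite lerD2l lerN2.
  rewrite -subr_ge0.
  rewrite (_ : _ - _ = ((7 * k + 2) * (k - 1)) / (6 * k * (2 * k + 1) * (k + 1) * (k + 2))); last first.
    by field; rewrite ?cn0 ?kn ?cn1 ?cn2 ?cn3.
  by rewrite divr_ge0 ?mulr_ge0 //; lra.
Qed.

Lemma stirling_gap_near (R : realType) (n y : nat) : (y <= n)%N ->
  `|stirling_gap y - stirling_gap n| <= y.+1%:R^-1 :> R.
Proof.
move=> yn; apply: le_trans (_ : y.+1%:R^-1 - n.+1%:R^-1 <= _); last first.
  by rewrite gerBl invr_ge0 ler0n.
elim: n yn => [|n IH]; first by rewrite leqn0 => /eqP ->; rewrite !subrr normr0.
rewrite leq_eqVlt => /predU1P[->|yn]; first by rewrite !subrr normr0.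
have := stirling_gapS R n; rewrite distrC; have := IH yn; move=> h1 h2.
rewrite (_ : _ - _ = (stirling_gap y - stirling_gap n) +
  (stirling_gap n - stirling_gap n.+1)); last by ring.
apply: le_trans (ler_normD _ _) _; apply: le_trans (lerD h1 h2) _.
by rewrite addrA subrK.
Qed.

Lemma ln_max_lik_arcsin_out_near (R : realType) (n y : nat) : (y <= n)%N ->
  `|ln (max_lik n y / arcsin_out n y) - red_cst n| <= edge_wt n y :> R.
Proof.
move=> yn; rewrite ln_max_lik_arcsin_out // /red_cst.
have h1 := stirling_gap_near R n y yn.
have h2 := stirling_gap_near R n (n - y)%N (leq_subr _ _).
rewrite (_ : _ - _ = (stirling_gap y - stirling_gap n) + (stirling_gap (n - y) - stirling_gap n));
  last by ring.
exact: le_trans (ler_normD _ _) (lerD h1 h2).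
Qed.

Definition rel_ent {R : realType} (n : nat) (V : nat -> R) (x : R) : R :=
  binE n x (fun y => ln (binW n y x / V y)).

(** [binW] is [max_lik] times the exponential of [- type_div]. The factor [binW] in front covers the
    outputs of probability zero. *)
Lemma ln_binW_div (R : realType) (n y : nat) (x v : R) : (y <= n)%N -> 0 <= x <= 1 -> 0 < v ->
  binW n y x * ln (binW n y x / v) = binW n y x * (ln (max_lik n y / v) - type_div n x y).
Proof.
move=> yn x01 v0; have := binW_ge0 _ n y _ x01; rewrite le_eqVlt => /predU1P[<-|w0].
  by rewrite !mul0r.
congr (_ * _); have [/andP[x0 x1] c0] : 0 <= x <= 1 /\ 0 < 'C(n, y)%:R :> R.
  by rewrite ltr0n bin_gt0.
have m0 := max_lik_gt0 R _ _ yn.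
rewrite [ln (binW n y x / v)]ln_div ?posrE // [ln (max_lik n y / v)]ln_div ?posrE //.
have xy : 0 < x ^+ y.
  rewrite lt_def exprn_ge0 // andbT; apply/eqP => e; move: w0.
  by rewrite /binW e mulr0 mul0r ltxx.
have xy' : 0 < (1 - x) ^+ (n - y).
  rewrite lt_def exprn_ge0 ?subr_ge0 // andbT; apply/eqP => e; move: w0.
  by rewrite /binW e mulr0 ltxx.
have p1 := natX_gt0 R y; have p2 := natX_gt0 R (n - y); have p3 := natX_gt0 R n.
have -> : ln (binW n y x) = ln 'C(n, y)%:R + ln (x ^+ y) + ln ((1 - x) ^+ (n - y)).
  by rewrite !lnM ?posrE ?mulr_gt0.
have -> : ln (max_lik n y) = ln 'C(n, y)%:R + (y%:R * ln y%:R + (n - y)%:R * ln (n - y)%:R)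
    - n%:R * ln n%:R :> R.
  by rewrite -!ln_natX -!lnM ?posrE ?mulr_gt0 // -ln_div ?posrE ?mulr_gt0.
have part (k : nat) (z : R) : (k <= n)%N -> 0 <= z -> 0 < z ^+ k ->
    k%:R * ln (k%:R / (n%:R * z)) = k%:R * ln k%:R - k%:R * ln n%:R - ln (z ^+ k).
  case: k => [|k] kn z0 zk; first by rewrite expr0 ln1 !mul0r; ring.
  have z0' : 0 < z.
    by rewrite lt_def z0 andbT; apply: contraTneq zk => ->; rewrite expr0n ltxx.
  have n0 : (0 < n)%N by apply: leq_trans kn.
  by rewrite ln_div ?posrE ?mulr_gt0 ?ltr0n // lnM ?posrE ?ltr0n // lnXn // -mulr_natl; ring.
rewrite /type_div !part ?leq_subr ?subr_ge0 // natrB //; ring.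
Qed.

(** The constant is [4 = 1 + 3]: one [edge_wt] from the Stirling gaps and three from the mean of
    [type_div]. *)
Lemma rel_ent_arcsin_out (R : realType) (n : nat) (x : R) : (0 < n)%N -> 0 <= x <= 1 ->
  `|rel_ent n (arcsin_out n) x - (red_cst n - 1 / 2)| <= 4 * binE n x (edge_wt n).
Proof.
move=> n0 x01.
have -> : rel_ent n (arcsin_out n) x =
    binE n x (fun y => ln (max_lik n y / arcsin_out n y) - red_cst n) + red_cst n
    - binE n x (type_div n x).
  rewrite /rel_ent /binE -[X in _ + X - _](binE_cst _ n x) /binE -big_split -sumrB.
  apply: eq_bigr => y _; have yn : (y <= n)%N by rewrite -ltnS.
  by rewrite ln_binW_div ?arcsin_out_gt0 //=; ring.
have h := binE_type_div _ _ _ n0 x01.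
rewrite (_ : _ - _ = binE n x (fun y => ln (max_lik n y / arcsin_out n y) - red_cst n) +
  - (binE n x (type_div n x) - 1 / 2)); last by ring.
apply: le_trans (ler_normD _ _) _; rewrite normrN.
have -> : 4 * binE n x (edge_wt n) = binE n x (edge_wt n) + 3 * binE n x (edge_wt n) by ring.
apply: lerD; last exact: h.
apply: le_trans (ler_norm_sum _ _ _) _; apply: ler_sum => y _.
have yn : (y <= n)%N by rewrite -ltnS.
rewrite normrM ger0_norm ?binW_ge0 //.
by rewrite ler_wpM2l ?binW_ge0 // ln_max_lik_arcsin_out_near.
Qed.

(** * The kernel of the arcsine input and its cosine expansion *)

(** The binomial expansion of [(e^(iu) + e^(-iu))^m], proved in real form from the product formula
    for cosines and Pascal's rule. *)
Lemma expr2cos (R : realType) (m : nat) (u : R) :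
  (2 * cos u) ^+ m = \sum_(j < m.+1) 'C(m, j)%:R * cos ((m%:R - 2 * j%:R) * u).
Proof.
elim: m => [|m IH].
  by rewrite expr0 big_ord1 bin0 mul1r mulr0 subrr mul0r cos0.
rewrite exprS IH mulr_sumr.
have st (a : R) : 2 * cos u * cos (a * u) = cos ((a + 1) * u) + cos ((a - 1) * u).
  have -> : (a + 1) * u = a * u + u by ring.
  have -> : (a - 1) * u = a * u - u by ring.
  by rewrite cosD cosB; ring.
rewrite (eq_bigr (fun j : 'I_m.+1 => 'C(m, j)%:R * cos ((m.+1%:R - 2 * j%:R) * u) +
    'C(m, j)%:R * cos ((m.+1%:R - 2 * j.+1%:R) * u))); last first.
  move=> j _; rewrite mulrCA st mulrDr -[m.+1%:R]natr1 -[j.+1%:R]natr1.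
  by congr (_ * cos (_ * u) + _ * cos (_ * u)); ring.
rewrite big_split /= [RHS]big_ord_recl [X in X + _ = _]big_ord_recl /= -addrA; congr (_ + _).
  by rewrite !bin0.
rewrite (eq_bigr (fun i : 'I_m => 'C(m, i.+1)%:R * cos ((m.+1%:R - 2 * i.+1%:R) * u)));
  last by move=> i _; rewrite /bump leq0n add1n.
rewrite [RHS](eq_bigr (fun i : 'I_m.+1 =>
   'C(m, i.+1)%:R * cos ((m.+1%:R - 2 * i.+1%:R) * u) +
   'C(m, i)%:R * cos ((m.+1%:R - 2 * i.+1%:R) * u))); last first.
  by move=> i _; rewrite /bump leq0n add1n binS natrD mulrDl.
by rewrite big_split /= [X in _ = X + _]big_ord_recr /= bin_small // mul0r addr0.
Qed.

Lemma sum_ord_doubleS (V : nmodType) (n : nat) (F : nat -> V) :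
  \sum_(i < n.*2.+1) F i = \sum_(y < n.+1) F y.*2 + \sum_(y < n) F y.*2.+1.
Proof.
elim: n => [|n IH]; first by rewrite !big_ord1 big_ord0 addr0.
rewrite doubleS big_ord_recr [X in X + _ = _]big_ord_recr /= IH.
rewrite [X in _ = X + _]big_ord_recr [X in _ = _ + X]big_ord_recr /= doubleS.
by rewrite addrACA -addrA [F _ + F _]addrC !addrA.
Qed.

Lemma sum_even_binomial (R : numFieldType) (n : nat) (a b : R) :
  \sum_(y < n.+1) 'C(n.*2, y.*2)%:R * (a ^+ y.*2 * b ^+ (n - y).*2) =
  ((b + a) ^+ n.*2 + (b - a) ^+ n.*2) / 2.
Proof.
rewrite !exprDn -big_split /=.
rewrite (sum_ord_doubleS _ n (fun i => b ^+ (n.*2 - i) * a ^+ i *+ 'C(n.*2, i) +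
   b ^+ (n.*2 - i) * (- a) ^+ i *+ 'C(n.*2, i))).
rewrite [X in _ + X]big1 ?addr0; last first.
  by move=> y _; rewrite exprNn -signr_odd /= odd_double expr1 mulN1r mulrN mulNrn subrr.
rewrite mulr_suml; apply: eq_bigr => y _.
by rewrite exprNn -signr_odd odd_double expr0 mul1r -doubleB -mulr_natl; field.
Qed.

(** The even binomial sum with [a = sin u * sin v] and [b = cos u * cos v] is the mean of the powers
    [2n] of [cos (u - v)] and [cos (u + v)]; both are then expanded in cosines. *)
Lemma sum_binW_kernel (R : realType) (n : nat) (u v : R) :
  \sum_(y < n.+1) 'C(n.*2, y.*2)%:R * ((sin u ^+ 2) ^+ y * (1 - sin u ^+ 2) ^+ (n - y)) *
      ((sin v ^+ 2) ^+ y * (1 - sin v ^+ 2) ^+ (n - y)) =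
  (\sum_(j < n.*2.+1) 'C(n.*2, j)%:R *
    (cos (2 * (n%:R - j%:R) * u) * cos (2 * (n%:R - j%:R) * v))) / 4 ^+ n.
Proof.
rewrite (eq_bigr (fun y : 'I_n.+1 => 'C(n.*2, y.*2)%:R *
   ((sin u * sin v) ^+ y.*2 * (cos u * cos v) ^+ (n - y).*2))); last first.
  move=> y _; rewrite -mulrA; congr (_ * _).
  by rewrite -!cos2sin2 -!muln2 ![(_ * 2)%N]mulnC !exprM mulrACA -!exprMn.
rewrite sum_even_binomial -cosD -cosB.
have n4 : 4 ^+ n = 2 ^+ n.*2 :> R by rewrite -mul2n exprM; congr (_ ^+ _); ring.
have n2 : n.*2%:R = 2 * n%:R :> R by rewrite -mul2n natrM.
have c (w : R) : cos w ^+ n.*2 = (\sum_(j < n.*2.+1) 'C(n.*2, j)%:R * cos (2 * (n%:R - j%:R) * w)) / 4 ^+ n.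
  have f4 : 4 ^+ n != 0 :> R by rewrite expf_neq0.
  apply: (canRL (mulfK f4)); rewrite n4 mulrC -exprMn expr2cos; apply: eq_bigr => j _.
  by congr (_ * cos (_ * w)); rewrite n2; ring.
rewrite !c -mulrDl -big_split mulrAC; congr (_ / _); rewrite mulr_suml; apply: eq_bigr => j _.
set l := 2 * (n%:R - _).
by rewrite [l * (u + v)]mulrDr [l * (u - v)]mulrBr cosB cosD /=; field.
Qed.

(** Dividing by [arcsin_out] turns the squared coefficients ['C(n, y)] into ['C(n.*2, y.*2)], as the
    even binomial sum requires. *)
Lemma arcsin_outE (R : realType) (n y : nat) : (y <= n)%N ->
  arcsin_out n y * 'C(n.*2, y.*2)%:R = 'C(n, y)%:R ^+ 2 * 'C(n.*2, n)%:R / 4 ^+ n :> R.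
Proof.
move=> yn; have fn (k : nat) : k`!%:R != 0 :> R by rewrite pnatr_eq0 -lt0n fact_gt0.
have binE' (a b : nat) : (b <= a)%N -> 'C(a, b)%:R = a`!%:R / (b`!%:R * (a - b)`!%:R) :> R.
  by move=> ba; rewrite -(bin_fact ba) !natrM mulfK // mulf_neq0.
have n4 : 4 ^+ n = 4 ^+ y * 4 ^+ (n - y) :> R by rewrite -exprD subnKC.
have f4 k : 4 ^+ k != 0 :> R by rewrite expf_neq0.
rewrite /arcsin_out /arcsin_wt n4 -!addnn !binE' ?leq_addr ?leq_add // !addnK.
have -> : (n + n - (y + y) = (n - y) + (n - y))%N by rewrite !addnn -doubleB.
by field; rewrite !fn !f4.
Qed.

Lemma sum_binW_div_arcsin_out (R : realType) (n : nat) (u v : R) :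
  \sum_(y < n.+1) binW n y (sin u ^+ 2) * binW n y (sin v ^+ 2) / arcsin_out n y =
  \sum_(j < n.*2.+1) 'C(n.*2, j)%:R / 'C(n.*2, n)%:R *
    (cos (2 * (n%:R - j%:R) * u) * cos (2 * (n%:R - j%:R) * v)).
Proof.
have c0 : 'C(n.*2, n)%:R != 0 :> R by rewrite pnatr_eq0 -lt0n bin_gt0 -addnn leq_addr.
have f4 : 4 ^+ n != 0 :> R by rewrite expf_neq0.
rewrite (eq_bigr (fun y : 'I_n.+1 => 4 ^+ n / 'C(n.*2, n)%:R *
  ('C(n.*2, y.*2)%:R * ((sin u ^+ 2) ^+ y * (1 - sin u ^+ 2) ^+ (n - y)) *
      ((sin v ^+ 2) ^+ y * (1 - sin v ^+ 2) ^+ (n - y))))); last first.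
  move=> y _; have yn : (y <= n)%N by rewrite -ltnS.
  have q0 := lt0r_neq0 (arcsin_out_gt0 R n y).
  have cy : 'C(n, y)%:R != 0 :> R by rewrite pnatr_eq0 -lt0n bin_gt0.
  have -> : 'C(n.*2, y.*2)%:R = 'C(n, y)%:R ^+ 2 * 'C(n.*2, n)%:R / 4 ^+ n / arcsin_out n y :> R.
    by rewrite -arcsin_outE // mulrC mulKf.
  by rewrite /binW; field; rewrite c0 f4 q0.
rewrite -mulr_sumr sum_binW_kernel mulrA mulr_sumr mulr_suml; apply: eq_bigr => j _.
by field; rewrite c0 f4.
Qed.

Lemma sum_cos_odd (R : realType) (a : R) (k : nat) :
  2 * sin a * \sum_(i < k) cos ((2 * i%:R + 1) * a) = sin (2 * k%:R * a).
Proof.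
elim: k => [|k IH]; first by rewrite big_ord0 !mulr0 mul0r sin0.
rewrite big_ord_recr /= mulrDr IH.
have -> : 2 * k%:R * a = (2 * k%:R + 1) * a - a by ring.
have -> : 2 * k.+1%:R * a = (2 * k%:R + 1) * a + a by rewrite -natr1; ring.
by rewrite sinB sinD; ring.
Qed.

Lemma sin_natpi (R : realType) (l : nat) : sin (l%:R * pi) = 0 :> R.
Proof.
elim: l => [|l IH]; first by rewrite mul0r sin0.
by rewrite -natr1 mulrDl mul1r sinDpi IH oppr0.
Qed.

(* The uniform law on the points [sin (cheb_node n k) ^+ 2], [k <= n], replaces the arcsine law:
   the two agree on polynomials of degree at most [n]. *)
Definition cheb_node {R : realType} (n k : nat) : R := (2 * k%:R + 1) * (pi / (4 * n.+1%:R)).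

(** The sum telescopes to a multiple of [sin (l * pi)], and the divisor [sin a] is nonzero because
    [0 < a < pi]. *)
Lemma sum_cos_cheb_node (R : realType) (n l : nat) : (0 < l <= n)%N ->
  \sum_(k < n.+1) cos (2 * l%:R * cheb_node n k) = 0 :> R.
Proof.
move=> /andP[l0 ln]; pose a : R := l%:R * pi / (2 * n.+1%:R).
have n0 : 0 < n.+1%:R :> R by rewrite ltr0n.
have nn := lt0r_neq0 n0.
have e (k : nat) : 2 * l%:R * cheb_node n k = (2 * k%:R + 1) * a.
  by rewrite /cheb_node /a; field.
rewrite (eq_bigr (fun k : 'I_n.+1 => cos ((2 * k%:R + 1) * a))); last first.
  by move=> k _; rewrite e.
have sa : 0 < sin a.
  apply: sin_gt0_pi; rewrite divr_gt0 ?mulr_gt0 ?pi_gt0 ?ltr0n //= ltr_pdivrMr ?mulr_gt0 //.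
  rewrite mulrC ltr_pM2l ?pi_gt0 //.
  by rewrite -natrM ltr_nat (leq_ltn_trans ln) // mul2n -addnn ltn_addr.
apply: (mulfI (_ : 2 * sin a != 0)); first by rewrite mulf_neq0 ?lt0r_neq0.
rewrite sum_cos_odd mulr0 (_ : 2 * n.+1%:R * a = l%:R * pi) ?sin_natpi //.
by rewrite /a; field.
Qed.

(** After division by [(1 - x)^n] the sum is the polynomial with coefficients [c] in the odds
    [x / (1 - x)]. At [x = k / (k + 1)] the odds are [k], which gives [n.+1] roots for a degree at
    most [n]. *)
Lemma bernstein_free (R : realFieldType) (n : nat) (c : nat -> R) :
  (forall x, 0 <= x <= 1 -> \sum_(y < n.+1) c y * (x ^+ y * (1 - x) ^+ (n - y)) = 0) ->
  forall y, (y <= n)%N -> c y = 0.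
Proof.
move=> h; pose p := \poly_(i < n.+1) c i.
suff p0 : p = 0.
  by move=> y yn; have := congr1 (fun q : {poly R} => q`_y) p0; rewrite coef_poly ltnS yn coef0.
apply/eqP; apply: contraT => pn0.
have := @max_poly_roots _ p [seq k%:R | k <- iota 0 n.+1] pn0.
rewrite size_map size_iota map_inj_uniq ?iota_uniq; last by move=> i j /eqP; rewrite eqr_nat => /eqP.
have -> : all (root p) [seq k%:R | k <- iota 0 n.+1].
  apply/allP => _ /mapP[k _ ->]; rewrite rootE horner_poly.
  have k1 : 0 < k%:R + 1 :> R by rewrite ltr_wpDl.
  have kn := lt0r_neq0 k1.
  have := h (k%:R / (k%:R + 1)); rewrite divr_ge0 ?(ltW k1) //= ler_pdivrMr // mul1r lerDl ler01.
  move=> /(_ isT) /(congr1 (fun z => (k%:R + 1) ^+ n * z)); rewrite mulr0 mulr_sumr => {2}<-.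
  apply/eqP/eq_bigr => y _; have yn : (y <= n)%N by rewrite -ltnS.
  have -> : 1 - k%:R / (k%:R + 1) = (k%:R + 1)^-1 :> R by field.
  have -> : (k%:R + 1) ^+ n = (k%:R + 1) ^+ y * (k%:R + 1) ^+ (n - y) :> R by rewrite -exprD subnKC.
  rewrite expr_div_n exprVn; field.
  by rewrite !expf_neq0.
by move=> /(_ isT isT) /leq_trans /(_ (size_poly _ _)); rewrite ltnn.
Qed.

(* Both sides have the same integral against the kernel of [sum_binW_kernel], for every [u]. *)
Lemma arcsin_out_node (R : realType) (n y : nat) : (y <= n)%N ->
  (\sum_(k < n.+1) binW n y (sin (cheb_node n k) ^+ 2)) / n.+1%:R = arcsin_out n y :> R.
Proof.
move=> yn; have n0 : n.+1%:R != 0 :> R by rewrite pnatr_eq0.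
pose nu (y : nat) : R := (\sum_(k < n.+1) (sin (cheb_node n k) ^+ 2) ^+ y *
  (1 - sin (cheb_node n k) ^+ 2) ^+ (n - y)) / n.+1%:R.
pose c (y : nat) : R := 'C(n.*2, y.*2)%:R * nu y - 'C(n.*2, n)%:R / 4 ^+ n * 'C(n, y)%:R.
(* The frequencies are at most [n] in absolute value, so averaging over the nodes keeps only
   [j = n]. *)
have avg_cos (j : 'I_n.*2.+1) (u : R) : \sum_(k < n.+1)
    cos (2 * (n%:R - j%:R) * u) * cos (2 * (n%:R - j%:R) * cheb_node n k)
    = (j == n :> nat)%:R * n.+1%:R.
  rewrite -mulr_sumr; have [jn|jn|jn] := ltngtP j n.
  - rewrite -natrB ?(ltnW jn) // sum_cos_cheb_node ?mulr0 ?mul0r //.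
    by rewrite subn_gt0 jn leq_subr.
  - rewrite (eq_bigr (fun k : 'I_n.+1 => cos (2 * (j - n)%:R * cheb_node n k))); last first.
      by move=> k _; rewrite -cosN; congr cos; rewrite natrB ?(ltnW jn) //; ring.
    rewrite sum_cos_cheb_node ?mulr0 ?mul0r // subn_gt0 jn leq_subLR.
    by rewrite addnn -ltnS ltn_ord.
  - rewrite jn subrr mulr0 !mul0r cos0 !mul1r (eq_bigr (fun=> 1)); last first.
      by move=> k _; rewrite mul0r cos0.
    by rewrite sumr_const card_ord.
have key u : \sum_(y < n.+1) 'C(n.*2, y.*2)%:R * ((sin u ^+ 2) ^+ y * (1 - sin u ^+ 2) ^+ (n - y))
    * nu y = 'C(n.*2, n)%:R / 4 ^+ n.
  transitivity ((\sum_(k < n.+1) (\sum_(y < n.+1) 'C(n.*2, y.*2)%:R *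
     ((sin u ^+ 2) ^+ y * (1 - sin u ^+ 2) ^+ (n - y)) *
     ((sin (cheb_node n k) ^+ 2) ^+ y * (1 - sin (cheb_node n k) ^+ 2) ^+ (n - y)))) / n.+1%:R).
    rewrite exchange_big /= mulr_suml; apply: eq_bigr => y' _.
    by rewrite /nu mulrA -mulr_sumr.
  rewrite (eq_bigr _ (fun (k : 'I_n.+1) _ => sum_binW_kernel _ n u (cheb_node n k))).
  rewrite -mulr_suml exchange_big /=.
  rewrite (eq_bigr (fun j : 'I_n.*2.+1 => 'C(n.*2, j)%:R * ((j == n :> nat)%:R * n.+1%:R))); last first.
    by move=> j _; rewrite -mulr_sumr avg_cos.
  have nn : (n < n.*2.+1)%N by rewrite ltnS -addnn leq_addr.
  rewrite (bigD1 (Ordinal nn)) //= eqxx mul1r big1 ?addr0; last first.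
    move=> j jn; rewrite (_ : (j == n :> nat) = false) ?mul0r ?mulr0 //.
    by apply/negbTE; apply: contraNneq jn => jn; apply/eqP/val_inj.
  by rewrite mulrAC mulfK.
have c0 : forall y, (y <= n)%N -> c y = 0.
  (* Every [x] in the unit interval is [sin u ^+ 2] with [u = asin (sqrt x)], so [key] holds for all
     of them. *)
  apply: bernstein_free => x /andP[x0 x1].
  have x1' : -1 <= Num.sqrt x <= 1.
    rewrite (le_trans _ (sqrtr_ge0 x)) ?lerN10 //=.
    by rewrite -[leRHS]sqrtr1 ler_wsqrtr.
  have xE : x = sin (asin (Num.sqrt x)) ^+ 2 by rewrite asinK ?sqr_sqrtr // in_itv.
  have := key (asin (Num.sqrt x)); rewrite -xE => keyx.
  rewrite (eq_bigr (fun y : 'I_n.+1 => 'C(n.*2, y.*2)%:R * (x ^+ y * (1 - x) ^+ (n - y)) * nu y -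
    'C(n.*2, n)%:R / 4 ^+ n * binW n y x)); last by move=> y' _; rewrite /c /binW; ring.
  by rewrite sumrB keyx -mulr_sumr sum_binW mulr1 subrr.
have b0 : 'C(n.*2, y.*2)%:R != 0 :> R by rewrite pnatr_eq0 -lt0n bin_gt0 leq_double.
apply: (mulIf b0); rewrite arcsin_outE // expr2.
have := c0 y yn => /eqP; rewrite subr_eq0 => /eqP e.
transitivity ('C(n, y)%:R * ('C(n.*2, y.*2)%:R * nu y)); last by rewrite e; ring.
rewrite /nu [in RHS]mulrA [in RHS]mulrA mulr_sumr mulrAC; congr (_ / _).
by rewrite mulr_suml; apply: eq_bigr => k _; rewrite /binW; ring.
Qed.

(** * Binomial coefficients near the centre *)

Lemma central_bin_ratio (R : realType) (n m l : nat) : (m.*2 <= n)%N -> (l <= m)%N ->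
  'C(n.*2, n)%:R * (1 - 2 * m%:R / n%:R) ^+ l <= 'C(n.*2, n + l)%:R :> R.
Proof.
move=> mn; elim: l => [|l IH] lm; first by rewrite expr0 mulr1 addn0.
have n0 : 0 < n%:R :> R.
  by rewrite ltr0n (leq_trans _ mn) // double_gt0 (leq_trans _ lm).
have b0 : 0 <= 1 - 2 * m%:R / n%:R :> R.
  by rewrite subr_ge0 ler_pdivrMr // mul1r -natrM ler_nat mul2n.
rewrite exprSr mulrA.
apply: le_trans (ler_wpM2r b0 (IH (ltnW lm))) _.
(* The ratio of consecutive coefficients is [(n - l) / (n + l + 1)], at least [1 - 2 m / n] when
   [l < m]. *)
have /(congr1 (fun k => k%:R : R)) := mul_bin_left n.*2 (n + l); rewrite !natrM.
have -> : (n.*2 - (n + l) = n - l)%N by rewrite -addnn subnDl.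
rewrite addnS => e.
have nl0 : 0 < (n + l).+1%:R :> R by rewrite ltr0n.
rewrite -(ler_pM2l nl0) e mulrCA [leRHS]mulrC ler_wpM2l //.
have ln : (l <= n)%N by rewrite (leq_trans (ltnW lm)) // (leq_trans _ mn) // -addnn leq_addr.
rewrite natrB // -[(n + l).+1%:R]natr1 natrD.
rewrite mulrBr mulr1 mulrA lerBlDr -lerBlDl ler_pdivlMr //.
have : (l%:R + 1 <= m%:R :> R) by rewrite natr1 ler_nat.
have : 0 <= l%:R :> R by [].
nra.
Qed.

Lemma central_bin_ratio_sym (R : realType) (n m j : nat) : (m.*2 <= n)%N ->
  (n <= j + m)%N -> (j <= n + m)%N ->
  'C(n.*2, n)%:R * (1 - 2 * m%:R / n%:R) ^+ m <= 'C(n.*2, j)%:R :> R.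
Proof.
move=> mn jm1 jm2.
wlog nj : j jm1 jm2 / (n <= j)%N => [hw|].
  have [|jn] := leqP n j; first exact: hw.
  have jn2 : (j <= n.*2)%N by rewrite (leq_trans (ltnW jn)) // -addnn leq_addr.
  have := hw (n.*2 - j)%N; rewrite bin_sub //; apply.
  - by rewrite -addnn -addnBA ?(ltnW jn) // -addnA leq_addr.
  - by rewrite leq_subLR -addnn addnCA leq_add2l.
  - by rewrite leq_subRL // -addnn leq_add2r ltnW.
have := @central_bin_ratio R n m (j - n)%N mn; rewrite subnKC // leq_subLR => /(_ jm2); apply: le_trans.
rewrite ler_wpM2l //.
have [->|n0] := posnP n.
  by rewrite invr0 mulr0 subr0 !expr1n.
apply: ler_wiXn2l; last by rewrite leq_subLR.
- by rewrite subr_ge0 ler_pdivrMr ?ltr0n // mul1r -natrM ler_nat mul2n.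
- by rewrite gerBl divr_ge0 // mulr_ge0.
Qed.

(** * A lower bound on the chi-square divergence *)

Lemma sum_sqr_ge_invn (R : realFieldType) (K : nat) (p : 'I_K -> R) :
  \sum_i p i = 1 -> K%:R^-1 <= \sum_i p i ^+ 2.
Proof.
move=> p1; have K0 : (0 < K)%N.
  by case: K p p1 => // p; rewrite big_ord0 => /eqP; rewrite eq_sym oner_eq0.
have Kn : K%:R != 0 :> R by rewrite pnatr_eq0 -lt0n.
have : 0 <= \sum_i (p i - K%:R^-1) ^+ 2 by apply: sumr_ge0 => i _; exact: sqr_ge0.
rewrite (eq_bigr (fun i => p i ^+ 2 - (2 / K%:R) * p i + K%:R ^- 2)); last first.
  by move=> i _; rewrite sqrrB exprVn; field.
rewrite big_split sumrB -mulr_sumr p1 sumr_const card_ord -mulr_natl /=.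
rewrite (_ : _ - _ + _ = \sum_i p i ^+ 2 - K%:R^-1) ?subr_ge0 //; by field.
Qed.

(** With [x = sin^2 u], [cos (2 a u)] is the Chebyshev polynomial of degree [a] at [1 - 2 x], so
    these are Chebyshev moments of the input. *)
Definition cos_mom {R : realType} (K : nat) (p u : 'I_K -> R) (a : R) : R :=
  \sum_i p i * cos (2 * a * u i).

(** The double sum is the squared modulus of the sum of the exponentials [e^(2 i a w)], an
    unnormalised Fejer kernel. *)
Lemma sum_dirichlet_ge0 (R : realType) (M : nat) (w : R) :
  0 <= \sum_(a < M) \sum_(b < M) cos (2 * (a%:R - b%:R) * w).
Proof.
have -> : \sum_(a < M) \sum_(b < M) cos (2 * (a%:R - b%:R) * w) =
    (\sum_(a < M) cos (2 * a%:R * w)) ^+ 2 + (\sum_(a < M) sin (2 * a%:R * w)) ^+ 2.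
  rewrite !expr2 !mulr_suml -big_split; apply: eq_bigr => a _ /=.
  rewrite !mulr_sumr -big_split; apply: eq_bigr => b _ /=.
  by rewrite -cosB; congr cos; ring.
by rewrite addr_ge0 ?sqr_ge0.
Qed.

(* Positivity of the Fejer kernel: only the diagonal pairs [i = i'] are kept. *)
Lemma sum_cos_mom_ge (R : realType) (K M : nat) (p u : 'I_K -> R) :
  (forall i, 0 <= p i) -> \sum_i p i = 1 ->
  M%:R ^+ 2 / (2 * K%:R) <= \sum_(a < M) \sum_(b < M) cos_mom K p u (a%:R - b%:R) ^+ 2.
Proof.
move=> p0 p1; pose D (w : R) : R := \sum_(a < M) \sum_(b < M) cos (2 * (a%:R - b%:R) * w).
have D0 : D 0 = M%:R ^+ 2.
  rewrite /D (eq_bigr (fun=> M%:R)); last first.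
    move=> a _; rewrite (eq_bigr (fun=> 1)) ?sumr_const ?card_ord // => b _.
    by rewrite mulr0 cos0.
  by rewrite sumr_const card_ord -[_ *+ _]mulr_natl expr2.
have -> : \sum_(a < M) \sum_(b < M) cos_mom K p u (a%:R - b%:R) ^+ 2 =
    \sum_i \sum_j p i * p j * ((D (u i - u j) + D (u i + u j)) / 2).
  transitivity (\sum_(a < M) \sum_(b < M) \sum_i \sum_j p i * p j *
     ((cos (2 * (a%:R - b%:R) * (u i - u j)) + cos (2 * (a%:R - b%:R) * (u i + u j))) / 2)).
    apply: eq_bigr => a _; apply: eq_bigr => b _.
    rewrite expr2 mulr_suml; apply: eq_bigr => i _.
    rewrite mulr_sumr; apply: eq_bigr => j _; set l := 2 * (_ - _).
    by rewrite [l * (u i - u j)]mulrBr [l * (u i + u j)]mulrDr cosB cosD; field.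
  rewrite (eq_bigr _ (fun (a : 'I_M) _ => exchange_big _ _ _ _ _ _)) exchange_big /=.
  apply: eq_bigr => i _.
  transitivity (\sum_(a < M) \sum_j \sum_(b < M) p i * p j * ((cos (2 * (a%:R - b%:R) * (u i - u j)) +
     cos (2 * (a%:R - b%:R) * (u i + u j))) / 2)).
    by apply: eq_bigr => a _; rewrite exchange_big.
  rewrite exchange_big; apply: eq_bigr => j _.
  rewrite /D -big_split mulr_suml mulr_sumr; apply: eq_bigr => a _.
  by rewrite -big_split mulr_suml mulr_sumr.
apply: le_trans (_ : \sum_i p i ^+ 2 * (M%:R ^+ 2 / 2) <= _).
  rewrite -mulr_suml invfM mulrA mulrC ler_wpM2r ?divr_ge0 ?sqr_ge0 //.
  exact: sum_sqr_ge_invn.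
have pp i j : 0 <= p i * p j * ((D (u i - u j) + D (u i + u j)) / 2).
  by rewrite !mulr_ge0 ?p0 // ?addr_ge0 ?sum_dirichlet_ge0.
apply: ler_sum => i _; rewrite (bigD1 i) //=.
apply: le_trans (_ : p i * p i * ((D (u i - u i) + D (u i + u i)) / 2) <= _); last first.
  by rewrite lerDl sumr_ge0.
rewrite -expr2 ler_wpM2l ?sqr_ge0 // ler_wpM2r ?invr_ge0 //.
by rewrite subrr D0 lerDl sum_dirichlet_ge0.
Qed.

Definition out_mix {R : realType} (n K : nat) (p x : 'I_K -> R) (y : nat) : R :=
  \sum_i p i * binW n y (x i).

(** The sum on the right is a weighted sum of squared cosine moments, and frequency zero accounts
    for the 1 subtracted. The Fejer double sum is treated row by row: each row meets [M] consecutive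
    frequencies, whose weights are at least the [M]-th power on the left. *)
Lemma chi2_arcsin_out_ge (R : realType) (n K M : nat) (p x : 'I_K -> R) :
  (0 < M)%N -> (M.*2 <= n)%N ->
  (forall i, 0 <= p i) -> \sum_i p i = 1 -> (forall i, 0 <= x i <= 1) ->
  (1 - 2 * M%:R / n%:R) ^+ M * (M%:R / (2 * K%:R) - 1) <=
  \sum_(y < n.+1) out_mix n K p x y ^+ 2 / arcsin_out n y - 1.
Proof.
move=> M0 Mn p0 p1 x01.
pose u i := asin (Num.sqrt (x i)).
have xE i : x i = sin (u i) ^+ 2.
  have /andP[x0 x1] := x01 i.
  rewrite /u asinK ?sqr_sqrtr // in_itv /= (le_trans _ (sqrtr_ge0 (x i))) ?lerN10 //=.
  by rewrite -[leRHS]sqrtr1 ler_wsqrtr.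
pose w (j : nat) : R := 'C(n.*2, j)%:R / 'C(n.*2, n)%:R.
pose T (j : nat) := w j * cos_mom K p u (n%:R - j%:R) ^+ 2.
pose rho := (1 - 2 * M%:R / n%:R : R) ^+ M.
have cn0 : 0 < 'C(n.*2, n)%:R :> R by rewrite ltr0n bin_gt0 -addnn leq_addr.
have T0 j : 0 <= T j by rewrite mulr_ge0 ?divr_ge0 ?sqr_ge0.
have SE : \sum_(y < n.+1) out_mix n K p x y ^+ 2 / arcsin_out n y = \sum_(j < n.*2.+1) T j.
  transitivity (\sum_i \sum_i' p i * p i' *
     (\sum_(y < n.+1) binW n y (x i) * binW n y (x i') / arcsin_out n y)).
    rewrite (eq_bigr (fun y : 'I_n.+1 => \sum_i \sum_i' p i * p i' *
      (binW n y (x i) * binW n y (x i') / arcsin_out n y))); last first.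
      move=> y _; rewrite expr2 !mulr_suml; apply: eq_bigr => i _.
      by rewrite mulr_sumr mulr_suml; apply: eq_bigr => i' _; ring.
    rewrite exchange_big; apply: eq_bigr => i _; rewrite exchange_big; apply: eq_bigr => i' _.
    by rewrite mulr_sumr.
  rewrite (eq_bigr (fun i => \sum_i' \sum_(j < n.*2.+1) p i * p i' * (w j *
     (cos (2 * (n%:R - j%:R) * u i) * cos (2 * (n%:R - j%:R) * u i'))))); last first.
    move=> i _; apply: eq_bigr => i' _; rewrite {1}(xE i) {1}(xE i').
    by rewrite sum_binW_div_arcsin_out mulr_sumr.
  under eq_bigr do rewrite exchange_big.
  rewrite exchange_big; apply: eq_bigr => j _ /=.
  rewrite /T /cos_mom expr2 mulr_suml mulr_sumr; apply: eq_bigr => i _.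
  by rewrite mulr_sumr mulr_sumr; apply: eq_bigr => i' _; ring.
set S := \sum_(y < n.+1) _.
have nM : (M <= n)%N by rewrite (leq_trans _ Mn) // -addnn leq_addr.
(* Row [a] sits at the indices [j = n - a + b]; its diagonal entry [b = a] is the frequency zero,
   removed from both sides. *)
have rowle (a : 'I_M) : rho * (\sum_(b < M) cos_mom K p u (a%:R - b%:R) ^+ 2 - 1) <= S - 1.
  have an : (a <= n)%N by rewrite (leq_trans _ nM) // ltnW.
  have mu0 : cos_mom K p u 0 = 1.
    by rewrite -p1; apply: eq_bigr => i _; rewrite mulr0 mul0r cos0 mulr1.
  have Tn : T n = 1 by rewrite /T /w subrr mu0 divff ?lt0r_neq0 // expr1n mulr1.
  have Tb (b : 'I_M) : rho * cos_mom K p u (a%:R - b%:R) ^+ 2 <= T (n - a + b)%N.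
    have e : n%:R - (n - a + b)%:R = a%:R - b%:R :> R by rewrite natrD natrB //; ring.
    rewrite /T e ler_wpM2r ?sqr_ge0 // ler_pdivlMr // mulrC.
    apply: central_bin_ratio_sym => //.
    - by rewrite -{1}(subnK an) -addnA leq_add2l ltnW // (leq_trans (ltn_ord a)) // leq_addl.
    - by rewrite leq_add ?leq_subr // ltnW.
  have TS : \sum_(b < M) T (n - a + b)%N <= S.
    rewrite /S SE -(big_mkord xpredT T).
    rewrite (@big_cat_nat _ _ _ (n - a)) //=; last first.
      by rewrite (leq_trans (leq_subr _ _)) // ltnW // ltnS -addnn leq_addr.
    rewrite (@big_cat_nat _ _ _ (n - a + M) (n - a)) ?leq_addr //=; last first.
      by rewrite ltnW // ltnS -addnn leq_add // leq_subr.
    have -> : \sum_(n - a <= i < n - a + M) T i = \sum_(b < M) T (n - a + b)%N.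
      rewrite -{1}[(n - a)%N]add0n big_addn addKn big_mkord.
      by apply: eq_bigr => b _; rewrite addnC.
    rewrite addrCA lerDl addr_ge0 //; by apply: sumr_ge0.
  apply: le_trans (lerB TS (lexx 1)).
  rewrite (bigD1 a) //= [X in _ <= X - 1](bigD1 a) //= subnK // Tn subrr mu0 expr1n.
  rewrite addrAC subrr add0r addrAC subrr add0r mulr_sumr.
  by apply: ler_sum => b _.
have : rho * (M%:R ^+ 2 / (2 * K%:R) - M%:R) <= M%:R * (S - 1).
  apply: le_trans (_ : \sum_(a < M) (S - 1) <= _); last first.
    by rewrite sumr_const card_ord mulr_natl.
  apply: le_trans (_ : \sum_(a < M) rho * (\sum_(b < M) cos_mom K p u (a%:R - b%:R) ^+ 2 - 1) <= _);
    last by apply: ler_sum.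
  rewrite -mulr_sumr ler_wpM2l //.
    rewrite exprn_ge0 // subr_ge0 ler_pdivrMr ?mul1r -?natrM ?ler_nat ?mul2n //.
    by rewrite ltr0n (leq_trans M0).
  by rewrite sumrB sumr_const card_ord lerD2r sum_cos_mom_ge.
have MR : 0 < M%:R :> R by rewrite ltr0n.
rewrite (_ : _ - M%:R = M%:R * (M%:R / (2 * K%:R) - 1)); last by rewrite expr2; ring.
by rewrite mulrCA ler_pM2l.
Qed.

(** * An upper bound on the optimal output law *)

Lemma type_div_ge0 (R : realType) (n y : nat) (x : R) : (0 < n)%N -> (y <= n)%N -> 0 < x < 1 ->
  0 <= type_div n x y.
Proof.
move=> n0 yn /andP[x0 x1]; have nR : 0 < n%:R :> R by rewrite ltr0n.
have m1 : 0 < n%:R * x by rewrite mulr_gt0.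
have m2 : 0 < n%:R * (1 - x) by rewrite mulr_gt0 // subr_gt0.
have [a _ _ _] := xln_div_bounds _ _ _ m1 (ler0n R y).
have [b _ _ _] := xln_div_bounds _ _ _ m2 (ler0n R (n - y)).
move: a b; rewrite /type_div natrB // => a b; lra.
Qed.

Lemma binW_gt0 (R : realType) (n y : nat) (x : R) : (y <= n)%N -> 0 < x < 1 -> 0 < binW n y x.
Proof.
move=> yn /andP[x0 x1]; rewrite /binW !mulr_gt0 ?exprn_gt0 ?subr_gt0 //.
by rewrite ltr0n bin_gt0.
Qed.

Lemma binW_le_max_lik (R : realType) (n y : nat) (x : R) : (0 < n)%N -> (y <= n)%N ->
  0 < x < 1 -> binW n y x <= max_lik n y.
Proof.
move=> n0 yn x01; have w0 := binW_gt0 _ _ _ _ yn x01; have m0 := max_lik_gt0 R _ _ yn.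
have /andP[/ltW x0 /ltW x1] := x01.
have := ln_binW_div _ n y x 1 yn; rewrite x0 x1 => /(_ isT ltr01) /(mulfI (lt0r_neq0 w0)).
rewrite !divr1 => e; rewrite -ler_ln ?posrE // e gerBl.
exact: type_div_ge0.
Qed.

(** Apart from [ln 'C(n, y)], the logarithm is affine in [y] with slope the log-odds of [x]; this
    makes the mixture log-convex after division by ['C(n, y)]. *)
Lemma ln_binW (R : realType) (n y : nat) (x : R) : (y <= n)%N -> 0 < x < 1 ->
  ln (binW n y x) = ln 'C(n, y)%:R + n%:R * ln (1 - x) + y%:R * (ln x - ln (1 - x)).
Proof.
move=> yn /andP[x0 x1]; have x1' : 0 < 1 - x by rewrite subr_gt0.
rewrite /binW !lnM ?posrE ?mulr_gt0 ?exprn_gt0 ?ltr0n ?bin_gt0 // !lnXn //.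
by rewrite -[_ *+ y]mulr_natl -[_ *+ (n - y)]mulr_natl natrB //; ring.
Qed.

Lemma jensen_ln (R : realType) (I : finType) (A : pred I) (s t : I -> R) :
  (forall i, A i -> 0 <= s i) -> \sum_(i | A i) s i = 1 -> (forall i, A i -> 0 < t i) ->
  \sum_(i | A i) s i * ln (t i) <= ln (\sum_(i | A i) s i * t i).
Proof.
move=> s0 s1 t0; set T := \sum_(i | A i) s i * t i.
have T0 : 0 < T.
  rewrite lt_def sumr_ge0 ?andbT => [|i Ai]; last by rewrite mulr_ge0 ?s0 ?ltW ?t0.
  apply: contraTneq (ltr01 : 0 < 1 :> R) => /eqP; rewrite psumr_eq0 => [|i Ai]; last first.
    by rewrite mulr_ge0 ?s0 ?ltW ?t0.
  move=> /allP h; rewrite -s1 big1 ?ltxx // => i Ai.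
  have := h i (mem_index_enum i); rewrite Ai /= mulf_eq0 => /orP[/eqP //|].
  by rewrite (gt_eqF (t0 i Ai)).
apply: le_trans (_ : \sum_(i | A i) s i * (ln T + (t i / T - 1)) <= _).
  apply: ler_sum => i Ai; rewrite ler_wpM2l ?s0 // -lerBlDl -ln_div ?posrE ?t0 //.
  by rewrite ln_le_sub1 // divr_gt0 // t0.
rewrite (eq_bigr (fun i => s i * (ln T - 1) + s i * t i / T)); last by move=> i _; ring.
rewrite big_split -!mulr_suml s1 mul1r mulfV ?lt0r_neq0 //=.
by rewrite subrK.
Qed.

(* Jensen's inequality with the posterior weights given [y]: the logarithm of the
   restricted mixture dominates an affine function of [y'] touching it at [y]. *)
Lemma out_mix_part_le (R : realType) (n K y : nat) (p x : 'I_K -> R) (C : R)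
    (A : pred 'I_K) (r : 'I_K) : (y <= n)%N ->
  (forall i, 0 < p i) -> (forall i, 0 <= x i <= 1) ->
  (forall y, (y <= n)%N -> 0 < out_mix n K p x y) ->
  rel_ent n (out_mix n K p x) (x r) = C ->
  0 < x r < 1 -> (forall j, A j -> 0 < x j < 1) ->
  (forall j, A j -> 0 <= (n%:R * x r - y%:R) * (x j - x r)) ->
  \sum_(j | A j) p j * binW n y (x j) <= expR (- C) * binW n y (x r).
Proof.
move=> yn p0 x01 Q0 Cr xr xA side.
set q := \sum_(j | A j) _; have wr := binW_gt0 _ _ _ _ yn xr.
have pw j : A j -> 0 < p j * binW n y (x j) by move=> Aj; rewrite mulr_gt0 ?binW_gt0 ?xA.
have : 0 <= q by apply: sumr_ge0 => j /pw/ltW.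
rewrite le_eqVlt => /predU1P[<-|q0].
  by rewrite mulr_ge0 ?expR_ge0 // ltW.
pose s j := p j * binW n y (x j) / q.
have s0 j : A j -> 0 <= s j by move=> Aj; rewrite divr_ge0 ?(ltW q0) // ltW // pw.
have s1 : \sum_(j | A j) s j = 1 by rewrite -mulr_suml mulfV // lt0r_neq0.
pose lg (z : R) := ln z - ln (1 - z).
pose La := \sum_(j | A j) s j * lg (x j).
have pt y' : (y' <= n)%N -> ln (binW n y' (x r) / out_mix n K p x y') <=
    ln (binW n y (x r) / q) + (y'%:R - y%:R) * (lg (x r) - La).
  move=> yn'; have Q0' := Q0 _ yn'; have wr' := binW_gt0 _ _ _ _ yn' xr.
  have : ln q + (\sum_(j | A j) s j * ln (binW n y' (x j) / binW n y (x j))) <= ln (out_mix n K p x y').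
    have tj j : A j -> 0 < binW n y' (x j) / binW n y (x j).
      by move=> Aj; rewrite divr_gt0 ?binW_gt0 ?xA.
    apply: le_trans (lerD (lexx _) (jensen_ln _ _ A s _ s0 s1 tj)) _.
    have -> : \sum_(j | A j) s j * (binW n y' (x j) / binW n y (x j)) =
        (\sum_(j | A j) p j * binW n y' (x j)) / q.
      rewrite mulr_suml; apply: eq_bigr => j Aj; have := lt0r_neq0 (binW_gt0 _ _ _ _ yn (xA j Aj)).
      by have := lt0r_neq0 q0; rewrite /s => ? ?; field; apply/andP.
    have le : \sum_(j | A j) p j * binW n y' (x j) <= out_mix n K p x y'.
      rewrite /out_mix [leRHS](bigID A) /= lerDl sumr_ge0 // => j _.
      by rewrite mulr_ge0 ?binW_ge0 // ltW.
    have S0 : 0 < \sum_(j | A j) p j * binW n y' (x j).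
      have [j Aj _] : exists2 j, A j & True.
        apply: contrapT => h; move: q0; rewrite /q big_pred0 ?ltxx // => j.
        by apply/negP => Aj; apply: h; exists j.
      rewrite (bigD1 j) //=; apply: ltr_pwDl; first by rewrite mulr_gt0 ?binW_gt0 ?xA.
      by apply: sumr_ge0 => i _; rewrite mulr_ge0 ?binW_ge0 // ltW.
    by rewrite ln_div ?posrE // addrC subrK ler_ln ?posrE.
  have -> : \sum_(j | A j) s j * ln (binW n y' (x j) / binW n y (x j)) =
      ln 'C(n, y')%:R - ln 'C(n, y)%:R + (y'%:R - y%:R) * La.
    rewrite (eq_bigr (fun j => (ln 'C(n, y')%:R - ln 'C(n, y)%:R) * s j +
        (y'%:R - y%:R) * (s j * lg (x j)))).
      by rewrite big_split -!mulr_sumr s1 mulr1.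
    move=> j Aj; rewrite ln_div ?posrE ?binW_gt0 ?xA // (ln_binW _ _ y') ?xA //.
    by rewrite (ln_binW _ _ y) ?xA // /lg; ring.
  rewrite [ln (_ / out_mix _ _ _ _ _)]ln_div ?posrE // [ln (_ / q)]ln_div ?posrE // !ln_binW // /lg; lra.
(* The expectation of the affine bound under the law of the atom [x r], whose mean is [n * x r]. *)
have : C <= ln (binW n y (x r) / q) + (n%:R * x r - y%:R) * (lg (x r) - La).
  rewrite -Cr; apply: le_trans (ler_binE _ _ _ _ _ (x01 r) pt) _.
  rewrite binED binE_cst lerD2l.
  rewrite (@eq_binE _ _ _ _ (fun y' => (lg (x r) - La) * y'%:R - y%:R * (lg (x r) - La)));
    last by move=> y' _; ring.
  by rewrite binED binEZ binE_cst binE_mean; lra.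
(* The log-odds are increasing, so the sign condition on the atoms in [A] makes the slope term
   nonpositive. *)
have : (n%:R * x r - y%:R) * (lg (x r) - La) <= 0.
  have -> : lg (x r) - La = - (\sum_(j | A j) s j * (lg (x j) - lg (x r))).
    rewrite (eq_bigr (fun j => s j * lg (x j) - s j * lg (x r))); last by move=> j _; ring.
    by rewrite sumrB -mulr_suml s1 mul1r opprB.
  rewrite mulrN oppr_le0 mulr_sumr; apply: sumr_ge0 => j Aj.
  rewrite mulrCA mulr_ge0 ?s0 //.
  have := side j Aj; have /andP[xj0 xj1] := xA j Aj; have /andP[xr0 xr1] := xr.
  have lg_mono (a b : R) : 0 < a -> b < 1 -> a <= b -> lg a <= lg b.
    move=> a0 b1 ab; have b0 := lt_le_trans a0 ab; have a1 := le_lt_trans ab b1.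
    by rewrite lerB // ler_ln ?posrE ?subr_gt0 // lerD2l lerN2.
  have [xx|xx|->] := ltgtP (x j) (x r); last by rewrite !subrr mulr0.
  - rewrite nmulr_lge0 ?subr_lt0 // => h; rewrite mulr_le0 // subr_le0.
    by rewrite lg_mono // ltW.
  - rewrite pmulr_lge0 ?subr_gt0 // => h; rewrite mulr_ge0 // subr_ge0.
    by rewrite lg_mono // ltW.
move=> h1 h2; have {h1 h2} : C <= ln (binW n y (x r) / q) by lra.
rewrite ln_div ?posrE // -ler_expR expRB !lnK ?posrE // expRN ler_pdivlMr // => h.
by rewrite ler_pdivlMl ?expR_gt0.
Qed.

Lemma binE_at0 (R : realType) (n : nat) (g : nat -> R) : binE n 0 g = g 0%N.
Proof.
rewrite /binE big_ord_recl big1 ?addr0 => [|i _].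
  by rewrite /binW bin0 expr0 subr0 expr1n !mul1r.
by rewrite /binW exprS mul0r mulr0 !mul0r.
Qed.

Lemma binW_at1 (R : realType) (n y : nat) : (y <= n)%N -> binW n y 1 = (y == n)%:R :> R.
Proof.
rewrite leq_eqVlt /binW => /predU1P[->|yn].
  by rewrite binn subnn expr1n expr0 !mul1r eqxx.
by rewrite subrr expr0n subn_eq0 leqNgt yn mulr0 (ltn_eqF yn).
Qed.

Lemma binE_at1 (R : realType) (n : nat) (g : nat -> R) : binE n 1 g = g n.
Proof.
rewrite /binE big_ord_recr big1 /= => [|i _].
  by rewrite binW_at1 // eqxx mul1r add0r.
by rewrite binW_at1 ?(ltnW (ltn_ord i)) // (ltn_eqF (ltn_ord i)) mul0r.
Qed.

Lemma max_lik0 (R : realType) (n : nat) : max_lik n 0 = 1 :> R.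
Proof. by rewrite /max_lik bin0 subn0 expr0 !mul1r mulfV // lt0r_neq0 ?natX_gt0. Qed.

Lemma max_likn (R : realType) (n : nat) : max_lik n n = 1 :> R.
Proof. by rewrite /max_lik binn subnn expr0 mul1r mulr1 mulfV // lt0r_neq0 ?natX_gt0. Qed.

(** The factor 2 comes from splitting the atoms at [y / n]: on each side the one-sided bound is
    applied at the atom nearest to [y / n]. Atoms at 0 and 1 are treated apart because their
    log-odds are infinite. *)
Lemma out_mix_le (R : realType) (n K y : nat) (p x : 'I_K -> R) (C : R) :
  (0 < n)%N -> (y <= n)%N ->
  (forall i, 0 < p i) -> (forall i, 0 <= x i <= 1) ->
  (forall y, (y <= n)%N -> 0 < out_mix n K p x y) ->
  (forall i, rel_ent n (out_mix n K p x) (x i) = C) ->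
  out_mix n K p x y <= 2 * expR (- C) * max_lik n y.
Proof.
move=> n0 yn p0 x01 Q0 HC; have nR : 0 < n%:R :> R by rewrite ltr0n.
have ml0 := max_lik_gt0 R _ _ yn; have eml0 : 0 < expR (- C) * max_lik n y.
  by rewrite mulr_gt0 ?expR_gt0.
have part (A : pred 'I_K) (r : 'I_K) : 0 < x r < 1 -> (forall j, A j -> 0 < x j < 1) ->
    (forall j, A j -> 0 <= (n%:R * x r - y%:R) * (x j - x r)) ->
    \sum_(j | A j) p j * binW n y (x j) <= expR (- C) * max_lik n y.
  move=> xr xA side; apply: le_trans (_ : expR (- C) * binW n y (x r) <= _).
    exact: (out_mix_part_le _ _ _ _ _ _ _ A r yn p0 x01 Q0 (HC r)).
  by rewrite ler_wpM2l ?expR_ge0 // binW_le_max_lik.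
have sub (A : pred 'I_K) : \sum_(j | A j) p j * binW n y (x j) <= out_mix n K p x y.
  rewrite /out_mix [leRHS](bigID A) /= lerDl sumr_ge0 // => j _.
  by rewrite mulr_ge0 ?binW_ge0 // ltW.
have end1 (y' : nat) : (y' <= n)%N -> ln (1 / out_mix n K p x y') = C -> out_mix n K p x y' = expR (- C).
  by move=> yn' <-; rewrite div1r lnV ?posrE ?Q0 // opprK lnK ?posrE ?Q0.
rewrite -mulrA [2 * _]mulr_natl mulr2n /out_mix (bigID (fun j => y%:R <= n%:R * x j)) /=.
apply: lerD.
(* For [y = n] only an atom at 1 lies in this half. Its law is a point mass at [n], so the equality
   there reads [Q(n) = e^-C]. *)
- have [yn'|] := eqVneq y n.
    subst y; have [[r xr]|h] := pselect (exists r, x r = 1).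
      apply: le_trans (sub _) _; rewrite max_likn mulr1 end1 //.
      by have := HC r; rewrite xr /rel_ent binE_at1 binW_at1 // eqxx.
    rewrite big_pred0 ?(ltW eml0) // => j; apply/negbTE/negP.
    rewrite -[leLHS]mulr1 ler_pM2l // => xj; apply: h; exists j.
    by apply/eqP; rewrite eq_le xj; have /andP[_ ->] := x01 j.
  move=> ynn; have yltn : (y < n)%N by rewrite ltn_neqAle ynn.
  (* For [y = 0] an atom at 0 likewise gives [Q(0) = e^-C]; otherwise the atoms that contribute here
     are interior. *)
  have [[/eqP y0 [r xr]]|h] := pselect ((y == 0%N) /\ exists r, x r = 0).
    subst y; apply: le_trans (sub _) _; rewrite max_lik0 mulr1 end1 //.
    by have := HC r; rewrite xr /rel_ent binE_at0 /binW bin0 expr0 subr0 expr1n !mul1r.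
  rewrite (bigID (fun j => x j < 1)) /= [X in _ + X]big1 ?addr0; last first.
    move=> j /andP[_]; rewrite -leNgt => xj.
    have -> : x j = 1 by apply/eqP; rewrite eq_le xj; have /andP[_ ->] := x01 j.
    by rewrite binW_at1 // (negbTE ynn) mulr0.
  pose A (j : 'I_K) := (y%:R <= n%:R * x j) && (x j < 1).
  have xA j : A j -> 0 < x j < 1.
    move=> /andP[yx ->]; rewrite andbT; have /andP[xj0 _] := x01 j.
    rewrite lt_def xj0 andbT; apply/negP => /eqP xj; apply: h; split; last by exists j.
    by move: yx; rewrite xj mulr0 lern0.
  have [[i0 Ai0]|hA] := pselect (exists j, A j); last first.
    rewrite big_pred0 ?(ltW eml0) // => j; apply/negbTE/negP => Aj; apply: hA; by exists j.
  have [r Ar rmin] := @Order.TotalTheory.arg_minP _ _ _ i0 A x Ai0.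
  apply: (part A r) => //; first exact: xA.
  move=> j Aj; rewrite mulr_ge0 ?subr_ge0 ?rmin //.
  by case/andP: Ar.
- rewrite (bigID (fun j => 0 < x j)) /= [X in _ + X]big1 ?addr0; last first.
    move=> j /andP[yx]; have /andP[xj0 _] := x01 j; rewrite -leNgt => xj.
    have xj' : x j = 0 by apply/eqP; rewrite eq_le xj xj0.
    move: yx; rewrite xj' mulr0 lern0 => /negbTE y0.
    by rewrite /binW expr0n y0 mulr0 mul0r mulr0.
  pose A (j : 'I_K) := ~~ (y%:R <= n%:R * x j) && (0 < x j).
  have xA j : A j -> 0 < x j < 1.
    move=> /andP[]; rewrite -ltNge => yx ->; rewrite -(ltr_pM2l nR) mulr1.
    by rewrite (lt_le_trans yx) // ler_nat.
  have [[i0 Ai0]|hA] := pselect (exists j, A j); last first.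
    rewrite big_pred0 ?(ltW eml0) // => j; apply/negbTE/negP => Aj; apply: hA; by exists j.
  have [r Ar rmax] := @Order.TotalTheory.arg_maxP _ _ _ i0 A x Ai0.
  apply: (part A r) => //; first exact: xA.
  move=> j Aj; rewrite mulr_le0 ?subr_le0 //; last exact: rmax.
  by case/andP: Ar; rewrite -ltNge => /ltW.
Qed.

(** Averages over the arcsine input become averages over finitely many nodes, at which the
    Kuhn-Tucker inequality can simply be summed. *)
Lemma sum_arcsin_out_binE (R : realType) (n : nat) (g : nat -> R) :
  (\sum_(k < n.+1) binE n (sin (cheb_node n k) ^+ 2) g) / n.+1%:R =
  \sum_(y < n.+1) arcsin_out n y * g y.
Proof.
rewrite exchange_big /= mulr_suml; apply: eq_bigr => y _.
by rewrite -arcsin_out_node -1?ltnS // -mulr_suml mulrAC.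
Qed.

Lemma sum_arcsin_out (R : realType) (n : nat) : \sum_(y < n.+1) arcsin_out n y = 1 :> R.
Proof.
have := sum_arcsin_out_binE R n (fun=> 1).
rewrite (eq_bigr (fun=> 1)) => [|k _]; last by rewrite binE_cst.
rewrite sumr_const card_ord mulfV ?pnatr_eq0 // => ->.
by apply: eq_bigr => y _; rewrite mulr1.
Qed.

Lemma sum_out_mix (R : realType) (n K : nat) (p x : 'I_K -> R) :
  \sum_i p i = 1 -> \sum_(y < n.+1) out_mix n K p x y = 1.
Proof.
move=> p1; rewrite exchange_big /= -[RHS]p1; apply: eq_bigr => i _.
by rewrite -mulr_sumr sum_binW mulr1.
Qed.

Lemma sum_out_mix_binE (R : realType) (n K : nat) (p x : 'I_K -> R) (g : nat -> R) :
  \sum_i p i * binE n (x i) g = \sum_(y < n.+1) out_mix n K p x y * g y.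
Proof.
rewrite (eq_bigr (fun i => \sum_(y < n.+1) p i * binW n y (x i) * g y)); last first.
  by move=> i _; rewrite /binE mulr_sumr; apply: eq_bigr => y _; rewrite mulrA.
by rewrite exchange_big; apply: eq_bigr => y _; rewrite /out_mix mulr_suml.
Qed.

Lemma rel_ent_change (R : realType) (n : nat) (V V' : nat -> R) (x : R) : 0 <= x <= 1 ->
  (forall y, (y <= n)%N -> 0 < V y) -> (forall y, (y <= n)%N -> 0 < V' y) ->
  rel_ent n V x = rel_ent n V' x + binE n x (fun y => ln (V' y / V y)).
Proof.
move=> x01 V0 V0'; rewrite /rel_ent /binE -big_split; apply: eq_bigr => y _ /=.
have yn : (y <= n)%N by rewrite -ltnS.
have := binW_ge0 _ n y _ x01; rewrite le_eqVlt => /predU1P[<-|w0]; first by rewrite !mul0r addr0.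
by rewrite !ln_div ?posrE ?V0 ?V0' //; ring.
Qed.

(** Both cases use [ln t >= 1 - 1 / t]. For [Q <= q] nothing is lost; for [q < Q] the loss is the
    factor [Q / q <= B]. Summed over the outputs, the right side is the symmetrised divergence. *)
Lemma chi2_le (R : realType) (B q Q : R) : 1 <= B -> 0 < q -> 0 < Q -> Q <= B * q ->
  (Q - q) ^+ 2 / q <= B * ((q - Q) * ln (q / Q)).
Proof.
move=> B1 q0 Q0 QB; have B0 : 0 < B by lra.
have [Qq|qQ] := leP Q q.
  have h := ln_ge_1subV R (q / Q) (divr_gt0 q0 Q0); rewrite invf_div in h.
  apply: le_trans (_ : 1 * ((q - Q) * (1 - Q / q)) <= _).
    by rewrite le_eqVlt; apply/orP; left; apply/eqP; field; exact: lt0r_neq0.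
  have g0 : 0 <= 1 - Q / q by rewrite subr_ge0 ler_pdivrMr // mul1r.
  apply: ler_pM => //; first by rewrite mulr_ge0 // subr_ge0.
  by rewrite ler_wpM2l // subr_ge0.
have h := ln_ge_1subV R (Q / q) (divr_gt0 Q0 q0); rewrite invf_div in h.
have -> : (q - Q) * ln (q / Q) = (Q - q) * ln (Q / q).
  by rewrite !ln_div ?posrE //; ring.
apply: le_trans (_ : B * ((Q - q) * (1 - q / Q)) <= _); last first.
  by rewrite ler_pM2l // ler_wpM2l // subr_ge0 ltW.
have -> : B * ((Q - q) * (1 - q / Q)) = (Q - q) ^+ 2 / q * (B * q / Q).
  by field; rewrite !lt0r_neq0.
by rewrite ler_peMr ?divr_ge0 ?sqr_ge0 ?(ltW q0) // ler_pdivlMr // mul1r.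
Qed.

(** * The chi-square divergence under the Kuhn-Tucker conditions *)

Lemma arcsin_wtS (R : realType) (y : nat) :
  arcsin_wt y.+1 = arcsin_wt y * ((2 * y%:R + 1) / (2 * y%:R + 2)) :> R.
Proof.
have y1 : 0 < y%:R + 1 :> R by rewrite ltr_wpDl.
have yn := lt0r_neq0 y1.
have fn : y`!%:R != 0 :> R by rewrite pnatr_eq0 -lt0n fact_gt0.
have cb (k : nat) : 'C(k.*2, k)%:R = (k.*2)`!%:R / (k`!%:R * k`!%:R) :> R.
  have kk : (k <= k.*2)%N by rewrite -addnn leq_addr.
  have kE : (k.*2 - k = k)%N by rewrite -addnn addnK.
  by rewrite -(bin_fact kk) kE !natrM mulfK.
rewrite /arcsin_wt !cb doubleS !factS !natrM exprS.
have -> : y.*2.+2%:R = 2 * (y%:R + 1) :> R by rewrite -addn2 -muln2 natrD natrM; ring.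
have -> : y.*2.+1%:R = 2 * y%:R + 1 :> R by rewrite -addn1 -muln2 natrD natrM; ring.
have -> : 2 * y%:R + 2 = 2 * (y%:R + 1) :> R by ring.
rewrite -[y.+1%:R]natr1; field.
by rewrite fn expf_neq0 //= yn.
Qed.

(** The induction step is [(2 y + 1) (2 y + 3) <= (2 y + 2)^2]. *)
Lemma arcsin_wt_sqr_le (R : realType) (y : nat) : arcsin_wt y ^+ 2 * (2 * y%:R + 1) <= 1 :> R.
Proof.
elim: y => [|y IH].
  by rewrite /arcsin_wt bin0 expr0 divr1 expr1n mulr0 add0r mulr1.
have y0 : 0 <= y%:R :> R by [].
apply: le_trans IH; rewrite arcsin_wtS exprMn -mulrA ler_wpM2l ?sqr_ge0 //.
rewrite -natr1 expr_div_n mulrAC ler_pdivrMr ?exprn_gt0 //; nra.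
Qed.

Lemma arcsin_out_le (R : realType) (n y : nat) : (y <= n)%N ->
  arcsin_out n y <= (Num.sqrt (n.+1%:R))^-1 :> R.
Proof.
move=> yn; have s0 : 0 < Num.sqrt n.+1%:R :> R by rewrite sqrtr_gt0 ltr0n.
rewrite -(@ler_pXn2r _ 2) ?nnegrE ?(ltW (arcsin_out_gt0 _ _ _)) ?invr_ge0 ?(ltW s0) //.
rewrite exprVn sqr_sqrtr // -[leRHS]div1r ler_pdivlMr ?ltr0n //.
apply: le_trans (_ : (arcsin_wt y ^+ 2 * (2 * y%:R + 1)) *
    (arcsin_wt (n - y) ^+ 2 * (2 * (n - y)%:R + 1)) <= _).
  rewrite mulrACA -exprMn ler_wpM2l ?sqr_ge0 //.
  have y0 : 0 <= y%:R :> R by [].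
  have k0 : 0 <= (n - y)%:R :> R by [].
  rewrite -{1}(subnKC yn) -natr1 natrD; nra.
rewrite mulr_ile1 ?arcsin_wt_sqr_le // mulr_ge0 ?sqr_ge0 // addr_ge0 // mulr_ge0 //.
Qed.

Lemma harmonic_le (R : realType) (n : nat) :
  \sum_(y < n.+1) (y.+1%:R)^-1 <= 1 + ln n.+1%:R :> R.
Proof.
elim: n => [|n IH]; first by rewrite big_ord1 ln1 invr1 addr0.
rewrite big_ord_recr /=; apply: le_trans (lerD IH (lexx _)) _.
rewrite -addrA lerD2l -lerBrDl -ln_div ?posrE ?ltr0n //.
apply: le_trans (ln_ge_1subV _ _ _); last by rewrite divr_gt0 ?ltr0n.
have a0 : 0 < n.+1%:R :> R by rewrite ltr0n.
rewrite invf_div -[n.+2%:R]natr1; move: (n.+1%:R) a0 => a a0.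
by rewrite le_eqVlt; apply/orP; left; apply/eqP; field; apply: lt0r_neq0; lra.
Qed.

(** The uniform bound on [arcsin_out] is pulled out; what remains is two harmonic sums exchanged by
    [y -> n - y]. *)
Lemma sum_arcsin_edge_wt_le (R : realType) (n : nat) :
  \sum_(y < n.+1) arcsin_out n y * edge_wt n y <=
  2 * (1 + ln n.+1%:R) / Num.sqrt n.+1%:R :> R.
Proof.
have s0 : 0 < Num.sqrt n.+1%:R :> R by rewrite sqrtr_gt0 ltr0n.
apply: le_trans (_ : \sum_(y < n.+1) (Num.sqrt n.+1%:R)^-1 * edge_wt n y <= _).
  apply: ler_sum => y _; rewrite ler_wpM2r ?edge_wt_ge0 // arcsin_out_le // -ltnS //.
rewrite -mulr_sumr mulrC ler_wpM2r ?invr_ge0 ?(ltW s0) //.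
rewrite big_split /= [X in _ + X](reindex_inj rev_ord_inj) /=.
rewrite (eq_bigr (fun i : 'I_n.+1 => i.+1%:R^-1)) => [|i _] //.
rewrite [X in _ + X](eq_bigr (fun i : 'I_n.+1 => i.+1%:R^-1)) => [|i _]; last first.
  by rewrite subSS subKn // -ltnS.
by have := harmonic_le R n; lra.
Qed.

Section KKT.
Context {R : realType} (n K : nat) (p x : 'I_K -> R) (C : R).
Local Notation Q := (out_mix n K p x).
Local Notation q := (@arcsin_out R n).
Hypothesis n0 : (0 < n)%N.
Hypothesis p0 : forall i, 0 < p i.
Hypothesis p1 : \sum_i p i = 1.
Hypothesis x01 : forall i, 0 <= x i <= 1.
Hypothesis Q0 : forall y, (y <= n)%N -> 0 < Q y.
Hypothesis kkt : forall z, 0 <= z <= 1 -> rel_ent n Q z <= C.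
Hypothesis kktE : forall i, rel_ent n Q (x i) = C.

Let G : R := \sum_(y < n.+1) q y * edge_wt n y.
Let avg : R := (\sum_(k < n.+1) rel_ent n q (sin (cheb_node n k) ^+ 2)) / n.+1%:R.

Let node01 (k : nat) : 0 <= sin (@cheb_node R n k) ^+ 2 <= 1.
Proof. by rewrite sqr_ge0 /= sin2cos2 gerBl sqr_ge0. Qed.

Let q0 y : 0 < q y :> R. Proof. exact: arcsin_out_gt0. Qed.

Let G2 : G <= 2.
Proof.
apply: le_trans (_ : \sum_(y < n.+1) q y * 2 <= _).
  by apply: ler_sum => y _; rewrite ler_wpM2l ?edge_wt_le2 // ltW.
by rewrite -mulr_suml sum_arcsin_out mul1r.
Qed.

Let avg_ge : red_cst n - 1 / 2 - 4 * G <= avg.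
Proof.
have N0 : 0 < n.+1%:R :> R by rewrite ltr0n.
rewrite /avg /G -sum_arcsin_out_binE mulrA lerBlDr -mulrDl ler_pdivlMr //.
rewrite -lerBlDr.
have -> : (red_cst n - 1 / 2) * n.+1%:R = \sum_(k < n.+1) (red_cst n - 1 / 2 : R).
  by rewrite sumr_const card_ord mulr_natr.
rewrite mulr_sumr -sumrB; apply: ler_sum => k _.
have := rel_ent_arcsin_out _ _ _ n0 (node01 k); rewrite ler_norml => /andP[h _]; lra.
Qed.

(** The Kuhn-Tucker inequality averaged over the nodes: replacing [Q] by [q] as reference law brings
    out the divergence of [q] from [Q]. *)
Let avg_change : avg + \sum_(y < n.+1) q y * ln (q y / Q y) <= C.
Proof.
have N0 : 0 < n.+1%:R :> R by rewrite ltr0n.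
rewrite -(sum_arcsin_out_binE R n (fun y => ln (q y / Q y))) /avg -mulrDl ler_pdivrMr // -big_split /=.
have -> : C * n.+1%:R = \sum_(k < n.+1) C by rewrite sumr_const card_ord mulr_natr.
apply: ler_sum => k _; rewrite -rel_ent_change //; first exact: kkt.
Qed.

(** The divergence of [q] from [Q] is nonnegative, and [1 / 2 + 4 G <= 17 / 2 <= 9]. *)
Let C_ge : red_cst n - 9 <= C.
Proof.
apply: le_trans avg_change; have : 0 <= \sum_(y < n.+1) q y * ln (q y / Q y).
  apply: le_trans (_ : \sum_(y < n.+1) (q y - Q y) <= _).
    by rewrite sumrB sum_arcsin_out sum_out_mix // subrr.
  apply: ler_sum => y _; have yn : (y <= n)%N by rewrite -ltnS.
  have := ler_wpM2l (ltW (q0 y)) (ln_ge_1subV _ _ (divr_gt0 (q0 y) (Q0 _ yn))); apply: le_trans.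
  by rewrite invf_div mulrBr mulr1 mulrC divfK // lt0r_neq0.
move: avg_ge G2; lra.
Qed.

(** The exponent is [12 = 1 + 2 + 9]: from [2 <= e], from [edge_wt <= 2], and from [C_ge]. *)
Let Qq y : (y <= n)%N -> Q y <= expR 12 * q y.
Proof.
move=> yn; apply: le_trans (out_mix_le _ _ _ _ _ _ _ n0 yn p0 x01 Q0 kktE) _.
have ml0 := max_lik_gt0 R _ _ yn.
have h : max_lik n y <= expR (red_cst n + 2) * q y :> R.
  have e : ln (max_lik n y / q y) <= red_cst n + 2 :> R.
    have := ln_max_lik_arcsin_out_near R n y yn; rewrite ler_norml => /andP[_].
    by have := edge_wt_le2 R n y; lra.
  have r0 : 0 < max_lik n y / q y by rewrite divr_gt0.
  by move: e; rewrite -ler_expR lnK ?posrE // ler_pdivrMr ?q0.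
apply: le_trans (_ : expR 1 * expR (- C) * (expR (red_cst n + 2) * q y) <= _).
  apply: ler_pM => //; first by rewrite mulr_ge0 ?expR_ge0.
  by rewrite ler_pM2r ?expR_gt0 //; have := @expR_ge1Dx R 1; lra.
rewrite mulrA -!expRD ler_pM2r // ler_expR; move: C_ge; lra.
Qed.

Lemma kkt_chi2_le :
  \sum_(y < n.+1) Q y ^+ 2 / q y - 1 <= expR 12 * (4 * ((expR 12 + 1) * G)).
Proof.
have -> : \sum_(y < n.+1) Q y ^+ 2 / q y - 1 = \sum_(y < n.+1) (Q y - q y) ^+ 2 / q y.
  rewrite [RHS](eq_bigr (fun y : 'I_n.+1 => Q y ^+ 2 / q y - 2 * Q y + q y)) => [|y _]; last first.
    by field; exact: lt0r_neq0.
  by rewrite big_split sumrB -mulr_sumr sum_arcsin_out sum_out_mix //=; ring.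
apply: le_trans (_ : \sum_(y < n.+1) expR 12 * ((q y - Q y) * ln (q y / Q y)) <= _).
  apply: ler_sum => y _; have yn : (y <= n)%N by rewrite -ltnS.
  apply: chi2_le; rewrite ?q0 ?Q0 ?Qq //.
  by have := @expR_ge1Dx R 12; lra.
rewrite -mulr_sumr ler_pM2l ?expR_gt0 //.
have -> : \sum_(y < n.+1) (q y - Q y) * ln (q y / Q y) =
    \sum_(y < n.+1) q y * ln (q y / Q y) - \sum_(y < n.+1) Q y * ln (q y / Q y).
  by rewrite -sumrB; apply: eq_bigr => y _; rewrite mulrBl.
(* The equality at the atoms averaged over the input; together with [avg_change] it eliminates
   [C]. *)
have CE : C = \sum_i p i * rel_ent n q (x i) + \sum_(y < n.+1) Q y * ln (q y / Q y).
  rewrite -(sum_out_mix_binE _ n _ _ _ (fun y => ln (q y / Q y))) -big_split /=.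
  rewrite -[LHS]mul1r -p1 mulr_suml; apply: eq_bigr => i _.
  by rewrite -mulrDr -rel_ent_change // kktE.
have PE : \sum_i p i * rel_ent n q (x i) <=
    red_cst n - 1 / 2 + 4 * \sum_(y < n.+1) Q y * edge_wt n y.
  rewrite -sum_out_mix_binE.
  have -> : red_cst n - 1 / 2 = \sum_i p i * (red_cst n - 1 / 2 : R) by rewrite -mulr_suml p1 [RHS]mul1r.
  rewrite mulr_sumr -big_split /=; apply: ler_sum => i _.
  rewrite mulrCA -mulrDr ler_pM2l //.
  have := rel_ent_arcsin_out _ _ _ n0 (x01 i); rewrite ler_norml => /andP[_]; lra.
(* The errors under [Q] are transferred to [q], whence the factor [expR 12 + 1] in the
   conclusion. *)
have QG : \sum_(y < n.+1) Q y * edge_wt n y <= expR 12 * G.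
  rewrite mulr_sumr; apply: ler_sum => y _; rewrite mulrA ler_wpM2r ?edge_wt_ge0 //.
  by rewrite Qq // -ltnS.
move: avg_change avg_ge CE PE QG; lra.
Qed.

End KKT.

Lemma kkt_atoms_bound (R : realType) (n K : nat) (p x : 'I_K -> R) (C : R) :
  (0 < n)%N -> (0 < K)%N -> (8 * K <= n)%N ->
  (forall i, 0 < p i) -> \sum_i p i = 1 -> (forall i, 0 <= x i <= 1) ->
  (forall y, (y <= n)%N -> 0 < out_mix n K p x y) ->
  (forall z, 0 <= z <= 1 -> rel_ent n (out_mix n K p x) z <= C) ->
  (forall i, rel_ent n (out_mix n K p x) (x i) = C) ->
  (1 - 8 * K%:R / n%:R) ^+ (4 * K) <=
  expR 12 * (4 * ((expR 12 + 1) * (2 * (1 + ln n.+1%:R) / Num.sqrt n.+1%:R))) :> R.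
Proof.
move=> n0 K0 Kn p0 p1 x01 Q0 kkt kktE.
apply: le_trans (le_trans (kkt_chi2_le _ _ _ _ _ n0 p0 p1 x01 Q0 kkt kktE) _); last first.
  rewrite ler_pM2l ?expR_gt0 // ler_pM2l // ler_pM2l ?addr_gt0 ?expR_gt0 //.
  exact: sum_arcsin_edge_wt_le.
(* The choice [M = 4 K] makes [M / (2 K) - 1] equal to 1. *)
have M0 : (0 < 4 * K)%N by rewrite muln_gt0.
have Mn : ((4 * K).*2 <= n)%N by rewrite -mul2n mulnA.
apply: le_trans (chi2_arcsin_out_ge _ _ _ _ _ _ M0 Mn (fun i => ltW (p0 i)) p1 x01).
have KR : K%:R != 0 :> R by rewrite pnatr_eq0 -lt0n.
have -> : (4 * K)%:R / (2 * K%:R) - 1 = 1 :> R by rewrite natrM; field.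
by rewrite mulr1 natrM (_ : 2 * (4%:R * K%:R) = 8 * K%:R) //; ring.
Qed.

(** * The Kuhn-Tucker conditions *)

Lemma mul_ln_le (R : realType) (a m : R) : 0 <= a -> 0 < m ->
  a * ln m <= a * ln a + m - a.
Proof.
rewrite le_eqVlt => /predU1P[<-|a0] m0; first by rewrite !mul0r add0r subr0 ltW.
have := ler_wpM2l (ltW a0) (ln_le_sub1 _ _ (divr_gt0 m0 a0)).
by rewrite ln_div ?posrE // !mulrBr mulr1 mulrCA mulfV ?lt0r_neq0 // mulr1; lra.
Qed.

Lemma convex_xlnx (R : realType) (a b t : R) : 0 <= a -> 0 <= b -> 0 < t < 1 ->
  ((1 - t) * a + t * b) * ln ((1 - t) * a + t * b) <= (1 - t) * (a * ln a) + t * (b * ln b).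
Proof.
move=> a0 b0 /andP[t0 t1]; pose m := (1 - t) * a + t * b; rewrite -/m.
have t1' : 0 <= 1 - t by rewrite subr_ge0 ltW.
have : 0 <= m by rewrite addr_ge0 // mulr_ge0 // ltW.
rewrite le_eqVlt => /predU1P[m0|m0].
  have := esym m0 => /eqP; rewrite /m paddr_eq0 ?mulr_ge0 ?(ltW t0) // !mulf_eq0.
  rewrite subr_eq0 (gt_eqF t1) (gt_eqF t0) /= => /andP[/eqP -> /eqP ->].
  by rewrite !(mulr0, mul0r, addr0).
have := ler_wpM2l t1' (mul_ln_le _ _ _ a0 m0); have := ler_wpM2l (ltW t0) (mul_ln_le _ _ _ b0 m0).
have -> : m * ln m = (1 - t) * (a * ln m) + t * (b * ln m) by rewrite {1}/m; ring.
have mE : m = (1 - t) * a + t * b by [].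
move: (ln m) mE => l; clearbody m => ->; lra.
Qed.

(** A tangent bound with quadratic error: along a perturbation of size [t] the error is of order
    [t^2]. *)
Lemma xlnx_le_tangent (R : realType) (u v : R) : 0 <= u -> 0 < v ->
  u * ln u - v * ln v <= (u - v) * (1 + ln v) + (u - v) ^+ 2 / v.
Proof.
move=> u0 v0; have [_ h _ _] := xln_div_bounds _ _ _ v0 u0; move: u0 h.
rewrite le_eqVlt => /predU1P[<-|u0]; first by rewrite !mul0r => h; lra.
by rewrite ln_div ?posrE // => h; lra.
Qed.

Lemma binW_le1 (R : realType) (n y : nat) (x : R) : (y <= n)%N -> 0 <= x <= 1 -> binW n y x <= 1.
Proof.
move=> yn x01; rewrite -(sum_binW R n x); have yn' : (y < n.+1)%N by [].
rewrite (bigD1 (Ordinal yn')) //= lerDl sumr_ge0 // => i _; exact: binW_ge0.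
Qed.

Definition bin_negent {R : realType} (n : nat) (x : R) : R := binE n x (fun y => ln (binW n y x)).

Section Optimality.
Context {R : realType} (n K : nat) (p x : 'I_K -> R) (C : R).
Local Notation Q := (@out_mix R n K p x).
Hypothesis p0 : forall i, 0 < p i.
Hypothesis p1 : \sum_i p i = 1.
Hypothesis x01 : forall i, 0 <= x i <= 1.
Hypothesis CE : C = \sum_(y < n.+1) \sum_i p i * xlogxq (binW n y (x i)) (Q y).
(** Optimality against the mixture of the input with a point mass [t] at [z], written as a finite
    sum. *)
Hypothesis opt : forall z t : R, 0 <= z <= 1 -> 0 < t < 1 ->
  \sum_(y < n.+1) ((1 - t) * (\sum_i p i * xlogxq (binW n y (x i)) ((1 - t) * Q y + t * binW n y z)) +
    t * xlogxq (binW n y z) ((1 - t) * Q y + t * binW n y z)) <= C.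

Let H : R := \sum_i p i * bin_negent n (x i).

Let Q_ge0 y : 0 <= Q y.
Proof. by apply: sumr_ge0 => i _; rewrite mulr_ge0 ?binW_ge0 // ltW. Qed.

Let Q_eq0 y i : Q y = 0 -> binW n y (x i) = 0.
Proof.
move=> /eqP; rewrite psumr_eq0 => [/allP/(_ i (mem_index_enum i))|j _]; last first.
  by rewrite mulr_ge0 ?binW_ge0 // ltW.
by rewrite /= mulf_eq0 (gt_eqF (p0 i)) => /eqP.
Qed.

Let xlogxqE (w v : R) : 0 <= w -> 0 <= v -> (v = 0 -> w = 0) ->
  xlogxq w v = w * ln w - w * ln v.
Proof.
rewrite /xlogxq; case: eqVneq => [->|wn] w0 v0 vw; first by rewrite !mul0r subrr.
have wp : 0 < w by rewrite lt_def wn.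
have vp : 0 < v by rewrite lt_def v0 andbT; apply: contra_neq wn => /vw.
by rewrite ln_div ?posrE // mulrBr.
Qed.

Let sumE (v : nat -> R) : (forall y, 0 <= v y) -> (forall y, v y = 0 -> Q y = 0) ->
  \sum_(y < n.+1) \sum_i p i * xlogxq (binW n y (x i)) (v y) =
  H - \sum_(y < n.+1) Q y * ln (v y).
Proof.
move=> v0 vQ; rewrite /H /bin_negent /binE.
rewrite (eq_bigr (fun i => \sum_(y < n.+1) p i * (binW n y (x i) * ln (binW n y (x i)))));
  last by move=> i _; rewrite mulr_sumr.
rewrite [X in _ = X - _]exchange_big -sumrB; apply: eq_bigr => y _.
rewrite /out_mix mulr_suml -sumrB; apply: eq_bigr => i _.
rewrite xlogxqE ?binW_ge0 //; first by ring.
by move=> /vQ /Q_eq0.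
Qed.

Let CH : C = H - \sum_(y < n.+1) Q y * ln (Q y).
Proof. by rewrite CE sumE. Qed.

Let Q_le1 y : (y <= n)%N -> Q y <= 1.
Proof.
move=> yn; rewrite -p1; apply: ler_sum => i _.
by rewrite ler_piMr ?binW_le1 // ltW.
Qed.

(** The conditional entropy is linear in the input, so optimality becomes a statement about the
    entropy of the output alone. *)
Let opt_xlnx (z t : R) : 0 <= z <= 1 -> 0 < t < 1 ->
  t * (bin_negent n z - H) <= \sum_(y < n.+1)
    (((1 - t) * Q y + t * binW n y z) * ln ((1 - t) * Q y + t * binW n y z) - Q y * ln (Q y)).
Proof.
move=> z01 t01; have := opt z t z01 t01 => /=; have /andP[t0 t1] := t01.
pose v y := (1 - t) * Q y + t * binW n y z.
have t1' : 0 < 1 - t by rewrite subr_gt0.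
have a0 y : 0 <= (1 - t) * Q y by rewrite mulr_ge0 // ltW.
have b0 y : 0 <= t * binW n y z by rewrite mulr_ge0 ?binW_ge0 // ltW.
have v0 y : 0 <= v y by rewrite addr_ge0.
have v0E y : v y = 0 -> Q y = 0 /\ binW n y z = 0.
  move=> /eqP; rewrite paddr_eq0 // => /andP[/eqP h1 /eqP h2]; split.
    by apply: (mulfI (lt0r_neq0 t1')); rewrite mulr0.
  by apply: (mulfI (lt0r_neq0 t0)); rewrite mulr0.
rewrite big_split -!mulr_sumr /= (sumE v) //; last by move=> y /v0E[].
rewrite [X in _ + t * X](eq_bigr (fun y : 'I_n.+1 =>
    binW n y z * ln (binW n y z) - binW n y z * ln (v y))); last first.
  by move=> y _; rewrite xlogxqE ?binW_ge0 //; [exact: v0|move=> /v0E[]].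
rewrite sumrB -/(binE n z (fun y => ln (binW n y z))) -/(bin_negent n z).
rewrite CH sumrB => h.
have -> : \sum_(y < n.+1) v y * ln (v y) =
    (1 - t) * (\sum_(y < n.+1) Q y * ln (v y)) + t * (\sum_(y < n.+1) binW n y z * ln (v y)).
  by rewrite !mulr_sumr -big_split; apply: eq_bigr => y _; rewrite /v /=; ring.
by move: h; lra.
Qed.

(* Moving mass [t] to [1/2] would gain a multiple of [t * ln (1 / t)] at an output
   of probability zero. *)
Lemma opt_out_gt0 y : (y <= n)%N -> 0 < Q y.
Proof.
move=> yn; rewrite lt_def Q_ge0 andbT; apply/negP => /eqP Qy0.
have z01 : 0 <= (2^-1 : R) <= 1 by lra.
have w0 : 0 < binW n y (2^-1 : R) by apply: binW_gt0 => //; lra.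
pose w : R := binW n y 2^-1; pose D := bin_negent n 2^-1 - H.
(* Output [y] contributes [t w ln (t w)]. By convexity every other output contributes at most [t],
   since [W ln W <= 0] and [Q ln Q >= -1]. *)
have key t : 0 < t < 1 -> D <= w * ln (t * w) + n.+1%:R.
  move=> t01; have /andP[t0 t1] := t01; rewrite -(ler_pM2l t0).
  apply: le_trans (opt_xlnx _ _ z01 t01) _.
  have yn' : (y < n.+1)%N by [].
  rewrite (bigD1 (Ordinal yn')) //= Qy0 mulr0 mul0r subr0 add0r -/w mulrDr -[t * w * _]mulrA.
  rewrite lerD2l.
  apply: le_trans (_ : \sum_(i < n.+1 | i != Ordinal yn') t <= _); last first.
    apply: le_trans (_ : \sum_(i < n.+1) t <= _).
      by rewrite [leRHS](bigD1 (Ordinal yn')) //= lerDr ltW.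
    by rewrite sumr_const card_ord mulr_natr.
  apply: ler_sum => i _; have i_n : (i <= n)%N by rewrite -ltnS.
  have W0 := binW_ge0 _ n i _ z01; have W1 := binW_le1 _ _ _ _ i_n z01.
  have := convex_xlnx _ _ _ _ (Q_ge0 i) W0 t01 => /= h.
  have lW : binW n i 2^-1 * ln (binW n i (2^-1 : R)) <= 0.
    by rewrite mulr_ge0_le0 // ln_le0.
  have lQ : - 1 <= Q i * ln (Q i).
    have := mul_ln_le _ (Q i) 1 (Q_ge0 i) ltr01; rewrite ln1 mulr0.
    by have := Q_le1 _ i_n; have := Q_ge0 i; lra.
  have := ler_wpM2l (ltW t0) lQ; have := ler_wpM2l (ltW t0) lW; lra.
(* At [t = e^-m] the term [- w m] outweighs all the constants, which contradicts [key]. *)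
pose m := (`|D - n.+1%:R - w * ln w| + 1) / w.
have m0 : 0 < m by rewrite divr_gt0 // ltr_wpDl.
have := key (expR (- m)); rewrite expR_gt0 expR_lt1 oppr_lt0 m0 => /(_ isT).
rewrite lnM ?posrE ?expR_gt0 // expRK mulrDr mulrN.
have -> : w * m = `|D - n.+1%:R - w * ln w| + 1 by rewrite /m mulrC divfK // lt0r_neq0.
have := ler_norm (- (D - n.+1%:R - w * ln w)); rewrite normrN; lra.
Qed.

(** The first-order condition at [t = 0]: the gain is [t (D(z|Q) - C)] up to [t^2 X]. *)
Lemma opt_rel_ent_le z : 0 <= z <= 1 -> rel_ent n Q z <= C.
Proof.
move=> z01; pose X := \sum_(y < n.+1) (binW n y z - Q y) ^+ 2 / Q y.
have relE : rel_ent n Q z = bin_negent n z - \sum_(y < n.+1) binW n y z * ln (Q y).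
  rewrite /rel_ent /bin_negent /binE -sumrB; apply: eq_bigr => y _.
  have yn : (y <= n)%N by rewrite -ltnS.
  have := binW_ge0 _ n y _ z01; rewrite le_eqVlt => /predU1P[<-|w0]; first by rewrite !mul0r subrr.
  by rewrite ln_div ?posrE ?opt_out_gt0 // mulrBr.
have key t : 0 < t < 1 -> rel_ent n Q z <= C + t * X.
  move=> t01; have /andP[t0 t1] := t01; rewrite -(ler_pM2l t0).
  have := opt_xlnx _ _ z01 t01.
  set S := \sum_(y < n.+1) _ => h.
  have hS : S <= \sum_(y < n.+1) (t * (binW n y z - Q y) +
      t * (binW n y z - Q y) * ln (Q y) + t ^+ 2 * ((binW n y z - Q y) ^+ 2 / Q y)).
    apply: ler_sum => y _; have yn : (y <= n)%N by rewrite -ltnS.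
    have Qy := opt_out_gt0 _ yn.
    have u0 : 0 <= (1 - t) * Q y + t * binW n y z.
      by rewrite addr_ge0 // mulr_ge0 ?binW_ge0 // ?subr_ge0 ltW.
    apply: le_trans (xlnx_le_tangent _ _ _ u0 Qy) _.
    by rewrite le_eqVlt; apply/orP; left; apply/eqP; field; exact: lt0r_neq0.
  rewrite !big_split /= -!mulr_sumr -/X in hS.
  rewrite sumrB sum_binW sum_out_mix // subrr mulr0 add0r in hS.
  have e : \sum_(y < n.+1) t * (binW n y z - Q y) * ln (Q y) =
     t * (\sum_(y < n.+1) binW n y z * ln (Q y) - \sum_(y < n.+1) Q y * ln (Q y)).
    by rewrite -sumrB mulr_sumr; apply: eq_bigr => y _; ring.
  rewrite e in hS; rewrite relE CH; move: h hS; rewrite expr2; lra.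
have X0 : 0 <= X.
  apply: sumr_ge0 => y _; have yn : (y <= n)%N by rewrite -ltnS.
  by rewrite divr_ge0 ?sqr_ge0 // ltW // opt_out_gt0.
rewrite leNgt; apply/negP => lt.
(* Small enough for [t * X] to be at most half of the supposed excess. *)
pose t := (rel_ent n Q z - C) / (2 * (rel_ent n Q z - C + X)).
have d0 : 0 < rel_ent n Q z - C by rewrite subr_gt0.
have dX : 0 < 2 * (rel_ent n Q z - C + X) by rewrite mulr_gt0 // ltr_pwDl.
have t0 : 0 < t by rewrite divr_gt0.
have t1 : t < 1 by rewrite ltr_pdivrMr // mul1r; lra.
have := key t; rewrite t0 t1 => /(_ isT).
have : t * X <= (rel_ent n Q z - C) / 2.
  have s0 : 0 < rel_ent n Q z - C + X by rewrite ltr_pwDl.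
  have -> : t * X = (rel_ent n Q z - C) / 2 * (X / (rel_ent n Q z - C + X)).
    by rewrite /t; field; rewrite lt0r_neq0.
  rewrite ler_piMr ?divr_ge0 ?(ltW d0) // ler_pdivrMr // mul1r; lra.
lra.
Qed.

(** The nonnegative gaps [C - D(x_j|Q)] average to zero under positive weights. *)
Lemma opt_rel_entE i : rel_ent n Q (x i) = C.
Proof.
have e : \sum_j p j * (C - rel_ent n Q (x j)) = 0.
  rewrite (eq_bigr (fun j => p j * C - p j * rel_ent n Q (x j))); last by move=> j _; rewrite mulrBr.
  rewrite sumrB -mulr_suml p1 mul1r {1}CE exchange_big /=.
  rewrite (eq_bigr (fun j => p j * rel_ent n Q (x j))) ?subrr // => j _.
  rewrite /rel_ent /binE mulr_sumr; apply: eq_bigr => y _; congr (_ * _).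
  by rewrite /xlogxq; case: eqVneq => [->|//]; rewrite mul0r.
move: e => /eqP; rewrite psumr_eq0 => [/allP/(_ i (mem_index_enum i))|j _]; last first.
  by rewrite mulr_ge0 ?(ltW (p0 j)) // subr_ge0 opt_rel_ent_le.
by rewrite /= mulf_eq0 (gt_eqF (p0 i)) subr_eq0 => /eqP.
Qed.

(** The inequality at [z = 0] and [z = 1] gives [Q(0)] and [Q(n)] at least [e^-C]; for [n > 0] these
    are distinct outputs, so their sum is at most 1. *)
Lemma opt_cap_ge : (0 < n)%N -> ln 2 <= C.
Proof.
move=> n0; have h0 : - ln (Q 0%N) <= C.
  have := opt_rel_ent_le 0; rewrite lexx ler01 /rel_ent binE_at0 => /(_ isT).
  by rewrite /binW bin0 expr0 subr0 expr1n !mul1r lnV ?posrE ?opt_out_gt0.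
have hn : - ln (Q n) <= C.
  have := opt_rel_ent_le 1; rewrite lexx ler01 /rel_ent binE_at1 => /(_ isT).
  by rewrite binW_at1 // eqxx mul1r lnV ?posrE ?opt_out_gt0.
have s : Q 0%N + Q n <= 1.
  rewrite -(sum_out_mix _ n _ p x p1) (bigD1 ord0) //= (bigD1 ord_max) /=; last by rewrite -lt0n.
  by rewrite lerD2l lerDl sumr_ge0.
rewrite -ler_expR lnK ?posrE // -[expR C]invrK -expRN.
have e0 : expR (- C) <= Q 0%N by rewrite -[leRHS]lnK ?posrE ?opt_out_gt0 // ler_expR; lra.
have en : expR (- C) <= Q n by rewrite -[leRHS]lnK ?posrE ?opt_out_gt0 // ler_expR; lra.
rewrite -[leLHS]invrK lef_pV2 ?posrE ?expR_gt0 ?invr_gt0 //; lra.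
Qed.

(** From [Q >= p_i W] with [W] the law of [x_i], the divergence at [x_i] is at most [- ln (p_i)].
    Hence [p_i <= e^-C], and the weights sum to 1. *)
Lemma opt_cap_le : C <= ln K%:R.
Proof.
have K0 : 0 < K%:R :> R.
  rewrite ltr0n; case: K p p1 => // p'; rewrite big_ord0 => /eqP.
  by rewrite eq_sym oner_eq0.
have Ki i : C <= - ln (p i).
  rewrite -(opt_rel_entE i) -[leRHS](binE_cst _ n (x i)) /rel_ent.
  apply: ler_sum => y _; have yn : (y <= n)%N by rewrite -ltnS.
  have := binW_ge0 _ n y _ (x01 i); rewrite le_eqVlt => /predU1P[<-|w0]; first by rewrite !mul0r.
  have Qy := opt_out_gt0 _ yn.
  rewrite ler_pM2l // -lnV ?posrE // ler_ln ?posrE ?divr_gt0 ?invr_gt0 //.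
  rewrite ler_pdivrMr // ler_pdivlMl // /out_mix (bigD1 i) //= lerDl sumr_ge0 // => j _.
  by rewrite mulr_ge0 ?binW_ge0 // ltW.
have pe i : p i <= expR (- C).
  by rewrite -[leLHS]lnK ?posrE // ler_expR; have := Ki i; lra.
have : 1 <= K%:R * expR (- C).
  rewrite -[leLHS]p1; apply: le_trans (ler_sum _ (fun i _ => pe i)) _.
  by rewrite sumr_const card_ord mulr_natl.
rewrite expRN ler_pdivlMr ?expR_gt0 // mul1r => h.
by rewrite -ler_expR lnK ?posrE.
Qed.

End Optimality.

(** * Probability measures with finite support *)

Lemma set_cons1 (T : eqType) (z : T) (s : seq T) :
  [set` z :: s] = [set z] `|` [set` s].
Proof.
apply/seteqP; split => x /=; rewrite inE.
  by move=> /orP[/eqP ->|xs]; [left|right].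
by move=> [->|xs]; rewrite ?eqxx // xs orbT.
Qed.

Lemma measurable_seq (R : realType) (s : seq R) : measurable [set` s].
Proof.
elim: s => [|z s IH]; last by rewrite set_cons1; apply: measurableU.
rewrite (_ : [set` [::]] = set0) //; by apply/seteqP; split.
Qed.

Lemma ge0_integral_seq (R : realType) (P : probability R R) (s : seq R) (g : R -> \bar R) :
  measurable_fun [set: R] g -> (forall x, 0 <= g x)%E -> (forall x, g x \is a fin_num) -> uniq s ->
  (\int[P]_(x in [set` s]) g x = \sum_(z <- s) g z * P [set z])%E.
Proof.
move=> mg g0 gf; elim: s => [|z s IH] /= => [_|/andP[zs us]].
  by rewrite big_nil (_ : [set` [::]] = set0) ?integral_set0 //; apply/seteqP; split.
rewrite big_cons -IH // set_cons1 ge0_integral_setU //=; first last.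
- by apply/disj_setPS => x [] /= -> ; rewrite (negbTE zs).
- exact: measurable_funS mg.
- exact: measurable_seq.
congr (_ + _)%E.
rewrite (@eq_integral _ _ _ _ _ (fun=> (fine (g z))%:E)) ?integral_cst //.
  by rewrite fineK.
by move=> x; rewrite inE => ->; rewrite fineK.
Qed.

(** Points of mass zero are allowed in [s], so that a law and its perturbation can be summed over
    the same list. *)
Definition seq_carries {R : realType} (P : probability R R) (s : seq R) : Prop :=
  [/\ uniq s, P (~` [set` s]) = 0%E & forall x, x \in s -> 0 <= x <= 1].

Definition mass {R : realType} (P : probability R R) (x : R) : R := fine (P [set x]).

Lemma massE (R : realType) (P : probability R R) (x : R) : P [set x] = (mass P x)%:E.
Proof. by rewrite fineK // fin_num_measure. Qed.

Lemma fine_integral_seq (R : realType) (P : probability R R) (s : seq R) (h : R -> R) :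
  measurable_fun [set: R] h -> seq_carries P s ->
  fine (\int[P]_(x in `[0%R, 1%R]) (h x)%:E)%E = \sum_(z <- s) mass P z * h z.
Proof.
move=> mh [us Ps s01].
have ge0 (g : R -> \bar R) : measurable_fun [set: R] g -> (forall x, 0 <= g x)%E ->
    (forall x, g x \is a fin_num) ->
    (\int[P]_(x in `[0%R, 1%R]) g x = (\sum_(z <- s) fine (g z) * mass P z)%:E)%E.
  move=> mg g0 gf.
  rewrite (@ge0_negligible_integral _ _ _ P _ (~` [set` s])) //; first last.
  - exact: measurable_funS mg.
  - by apply: measurableC; exact: measurable_seq.
  have -> : `[0%R, 1%R] `\` ~` [set` s] = [set` s] :> set R.
    rewrite setDE setCK; apply/seteqP; split => x /=; first by case.
    by move=> xs; split => //; rewrite in_itv /= s01.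
  rewrite ge0_integral_seq // -sumEFin; apply: eq_bigr => z _.
  by rewrite EFinM fineK // massE.
have mE : measurable_fun [set: R] (EFin \o h) by apply/measurable_EFinP.
(* The integrand may change sign; its positive and negative parts are summed separately. *)
rewrite integralE !ge0 //.
- rewrite -EFinB /= -sumrB; apply: eq_bigr => z _.
  rewrite -mulrBl mulrC; congr (_ * _).
  rewrite funeposE funenegE /= -!EFin_max /=.
  have [hz|/ltW hz] := lerP 0 (h z).
    by rewrite max_r ?oppr_le0 // subr0.
  by rewrite max_l ?oppr_ge0 // sub0r opprK.
- exact: measurable_funeneg.
- by move=> x; rewrite funenegE /= -EFin_max.
- exact: measurable_funepos.
- by move=> x; rewrite funeposE /= -EFin_max.
Qed.

Lemma seq_carries_sub (R : realType) (P : probability R R) (s s' : seq R) :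
  seq_carries P s -> uniq s' -> {subset s <= s'} -> (forall x, x \in s' -> 0 <= x <= 1) ->
  seq_carries P s'.
Proof.
move=> [_ Ps _] us' ss' s'01; split => //.
apply/eqP; rewrite eq_le measure_ge0 andbT -Ps le_measure ?inE //.
- by apply: measurableC; exact: measurable_seq.
- by apply: measurableC; exact: measurable_seq.
- by move=> x /= xs'; apply: contra_not xs' => /ss'.
Qed.

Lemma sum_mass (R : realType) (P : probability R R) (s : seq R) : seq_carries P s ->
  \sum_(z <- s) mass P z = 1.
Proof.
move=> [us Ps s01].
have Ps1 : P [set` s] = 1%E.
  have := probability_setC P (measurable_seq _ s); rewrite Ps => e.
  by rewrite -[[set` s]]setCK probability_setC ?Ps ?sube0 //; apply: measurableC; exact: measurable_seq.
apply/eqP; rewrite -(@eqe R) -sumEFin -Ps1; apply/eqP.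
have := @ge0_integral_seq R P s (fun=> 1%E) (measurable_cst _) _ _ us.
rewrite (@integral_cst _ _ _ _ _ (measurable_seq _ s) 1) mul1e => ->.
- by apply: eq_bigr => z _; rewrite mul1e massE.
- by [].
- by [].
Qed.

(** * Mixtures with a point mass *)

Definition mix_dirac {R : realType} (P : probability R R) (z : R) (t : {i01 R}) :
    set R -> \bar R :=
  measure_add (mscale ((1 - t%:num)%:nng) P) (mscale (t%:num%:nng) (\d_z)).

HB.instance Definition _ (R : realType) (P : probability R R) (z : R) (t : {i01 R}) :=
  Measure.on (mix_dirac P z t).

Lemma mix_diracE (R : realType) (P : probability R R) (z : R) (t : {i01 R}) (A : set R) :
  mix_dirac P z t A = ((1 - t%:num)%:E * P A + t%:num%:E * \d_z A)%E.
Proof. by rewrite /mix_dirac measure_addE. Qed.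

Lemma mix_dirac_setT (R : realType) (P : probability R R) (z : R) (t : {i01 R}) :
  mix_dirac P z t setT = 1%E.
Proof. by rewrite mix_diracE probability_setT diracT !mule1 -EFinD subrK. Qed.

HB.instance Definition _ (R : realType) (P : probability R R) (z : R) (t : {i01 R}) :=
  Measure_isProbability.Build _ _ _ (mix_dirac P z t) (mix_dirac_setT R P z t).

Lemma seq_carries_mix (R : realType) (P : probability R R) (s : seq R) (z : R) (t : {i01 R}) :
  seq_carries P s -> 0 <= z <= 1 -> seq_carries (mix_dirac P z t) (undup (z :: s)).
Proof.
move=> sP z01; have [us Ps s01] := sP; have s'01 x : x \in undup (z :: s) -> 0 <= x <= 1.
  by rewrite mem_undup inE => /orP[/eqP ->|/s01].
have ss' : {subset s <= undup (z :: s)} by move=> x xs; rewrite mem_undup inE xs orbT.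
have [_ Ps' _] := seq_carries_sub _ _ _ _ sP (undup_uniq _) ss' s'01.
split => //; first exact: undup_uniq.
have := mix_diracE R P z t (~` [set` undup (z :: s)]) => /= ->.
rewrite Ps' mule0 add0e diracE (_ : _ \in _ = false) ?mule0 //.
have zs : z \in undup (z :: s) by rewrite mem_undup mem_head.
by apply/negbTE; rewrite notin_setE => h; exact: (h zs).
Qed.

Lemma mass_mix (R : realType) (P : probability R R) (z w : R) (t : {i01 R}) :
  mass (mix_dirac P z t) w = (1 - t%:num) * mass P w + t%:num * (w == z)%:R.
Proof.
rewrite /mass; have := mix_diracE R P z t [set w] => /= ->.
rewrite massE diracE -!EFinM -EFinD /=; congr (_ + _ * _%:R).
case: eqVneq => [->|/eqP wz]; first by rewrite mem_set.
by rewrite memNset //= => zw; apply: wz.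
Qed.

Lemma fine_integral_mix (R : realType) (P : probability R R) (s : seq R) (z : R) (t : {i01 R})
    (h : R -> R) : measurable_fun [set: R] h -> seq_carries P s -> 0 <= z <= 1 ->
  fine (\int[mix_dirac P z t]_(x in `[0%R, 1%R]) (h x)%:E)%E =
  (1 - t%:num) * fine (\int[P]_(x in `[0%R, 1%R]) (h x)%:E)%E + t%:num * h z.
Proof.
move=> mh sP z01; have sM := seq_carries_mix _ _ _ _ t sP z01.
have [us' _ s'01] := sM.
have ss' : {subset s <= undup (z :: s)} by move=> x xs; rewrite mem_undup inE xs orbT.
rewrite (fine_integral_seq _ _ _ _ mh sM).
rewrite (fine_integral_seq _ _ _ _ mh (seq_carries_sub _ _ _ _ sP us' ss' s'01)).
rewrite mulr_sumr.
rewrite (eq_bigr (fun w => (1 - t%:num) * (mass P w * h w) + t%:num * ((w == z)%:R * h w))); last first.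
  by move=> w _; rewrite mass_mix; ring.
rewrite big_split -!mulr_sumr; congr (_ + _ * _).
have zs : z \in undup (z :: s) by rewrite mem_undup mem_head.
rewrite (bigD1_seq z zs us') eqxx mul1r big1 => [|w wz]; first exact: addr0.
by rewrite (negbTE wz) mul0r.
Qed.

Lemma input_distr_mix (R : realType) (P : probability R R) (z : R) (t : {i01 R}) :
  input_distr P -> 0 <= z <= 1 -> input_distr (mix_dirac P z t).
Proof.
rewrite /input_distr => P0 z01.
have := mix_diracE R P z t (~` `[(0%R:R), (1%R:R)]%classic) => /= ->.
rewrite P0 mule0 add0e diracE (_ : _ \in _ = false) ?mule0 //.
by apply/negbTE; rewrite notin_setE /= => h; apply: h; rewrite in_itv.
Qed.

(** * Measurability, and the support of a probability *)

Lemma measurable_binW (R : realType) (n y : nat) : measurable_fun [set: R] (@binW R n y).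
Proof.
rewrite /binW; apply: measurable_funM; first apply: measurable_funM.
- exact: measurable_cst.
- exact: measurable_funX.
- by apply: measurable_funX; apply: measurable_funB.
Qed.

Lemma measurable_xlogxq (R : realType) (n y : nat) (q : R) :
  measurable_fun [set: R] (fun x => xlogxq (binW n y x) q).
Proof.
have -> : (fun x => xlogxq (binW n y x) q) = (fun x => binW n y x * ln (binW n y x / q)).
  by apply/funext => x; rewrite /xlogxq; case: eqVneq => // ->; rewrite mul0r.
apply: measurable_funM; first exact: measurable_binW.
apply: measurableT_comp; first exact: measurable_ln.
by apply: measurable_funM; [exact: measurable_binW|exact: measurable_cst].
Qed.

(** A point outside the support has a null neighbourhood, hence lies in a null ball with rational
    centre and radius; there are countably many of these, enumerated by [unpickle]. *)
Lemma supp_null (R : realType) (P : probability R R) : P.-negligible (~` supp P).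
Proof.
pose F (k : nat) : set R := if unpickle k is Some (c, r) then
  (if P (ball (ratr c : R) (ratr r)) == 0%E then ball (ratr c : R) (ratr r) else set0) else set0.
apply: (@negligibleS _ _ _ _ (\bigcup_k F k)); last first.
  apply: negligible_bigcup => k; rewrite /F; case: unpickle => [[c r]|]; last exact: negligible_set0.
  case: eqP => [e|_]; last exact: negligible_set0.
  by exists (ball (ratr c : R) (ratr r)); split => //; exact: measurable_ball.
move=> x /= /existsNP[U /not_implyP[oU /not_implyP[Ux /negP PU]]].
have PU0 : P U = 0%E by apply/eqP; rewrite eq_le measure_ge0 andbT leNgt.
have [c [r [xB BU]]] := open_subball_rat oU (mem_set Ux).
exists (pickle (c, r)); first by [].
rewrite /F pickleK.
rewrite (_ : P _ == 0%E); first exact: set_mem.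
rewrite eq_le measure_ge0 andbT -PU0 le_measure ?inE //.
- exact: measurable_ball.
- exact: open_measurable.
Qed.

Lemma supp_carries (R : realType) (P : probability R R) (s : seq R) :
  input_distr P -> uniq s -> supp P = [set x | x \in s] -> seq_carries P s.
Proof.
move=> P01 us sE; split => //.
  have /negligibleP := supp_null R P; rewrite sE; apply.
  by apply: measurableC; exact: measurable_seq.
move=> x xs; have : supp P x by rewrite sE.
move=> /(_ (~` `[(0%R:R), (1%R:R)]%classic)) h; apply/negPn/negP => x01.
have := h; rewrite P01 ltxx => /(_ _ _)/negP; apply => //.
  by rewrite openC; exact: itv_closed.
by rewrite /= in_itv; apply/negP.
Qed.

(** The complement of the other points is an open neighbourhood of [z], covered by [z] and a null
    set. *)
Lemma supp_mass_gt0 (R : realType) (P : probability R R) (s : seq R) (z : R) :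
  seq_carries P s -> z \in s -> supp P z -> 0 < mass P z.
Proof.
move=> [us Ps s01] zs /(_ (~` [set` rem z s])) h; rewrite -lte_fin -massE.
apply: lt_le_trans (h _ _) _.
- rewrite openC; have /accessible_finite_set_closed := hausdorff_accessible (@Rhausdorff R).
  by apply; exact: finite_seq.
- by rewrite /= mem_rem_uniq // inE eqxx.
- rewrite -[leRHS]adde0 -Ps -measureU //.
  + apply: le_measure; rewrite ?inE //.
    * by apply: measurableC; exact: measurable_seq.
    * by apply: measurableU => //; apply: measurableC; exact: measurable_seq.
    move=> x /=; rewrite mem_rem_uniq // inE => /negP; rewrite negb_and negbK => /orP[/eqP|xs].
      by left.
    by right => /= xs'; rewrite xs' in xs.
  + by apply: measurableC; exact: measurable_seq.
  + by apply/seteqP; split => // x /= [-> h']; apply: h'.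
Qed.

(** * The bound on the support *)

Lemma fine_integral_ord (R : realType) (P : probability R R) (s : seq R) (h : R -> R) :
  measurable_fun [set: R] h -> seq_carries P s ->
  fine (\int[P]_(x in `[0%R, 1%R]) (h x)%:E)%E =
  \sum_(i < size s) mass P (nth 0 s i) * h (nth 0 s i).
Proof. by move=> mh sP; rewrite (fine_integral_seq _ _ _ _ mh sP) (big_nth 0) big_mkord. Qed.

Lemma capacity_achieving_opt (R : realType) (n : nat) (P : probability R R) (s : seq R) :
  capacity_achieving n P -> seq_carries P s ->
  let p (i : 'I_(size s)) := mass P (nth 0 s i) in
  let x (i : 'I_(size s)) := nth 0 s i in
  mutual_info n P =
    \sum_(y < n.+1) \sum_i p i * xlogxq (binW n y (x i)) (out_mix n (size s) p x y) /\
  forall z t : R, 0 <= z <= 1 -> 0 < t < 1 ->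
  \sum_(y < n.+1) ((1 - t) * (\sum_i p i * xlogxq (binW n y (x i))
      ((1 - t) * out_mix n (size s) p x y + t * binW n y z)) +
    t * xlogxq (binW n y z) ((1 - t) * out_mix n (size s) p x y + t * binW n y z)) <=
  mutual_info n P.
Proof.
move=> [P01 Popt] sP p x; have outE y : out_prob n P y = out_mix n (size s) p x y.
  by rewrite /out_prob (fine_integral_ord _ _ _ _ (measurable_binW R n y) sP).
split.
  apply: eq_bigr => y _; rewrite outE.
  by rewrite (fine_integral_ord _ _ _ _ (measurable_xlogxq R n y _) sP).
move=> z t z01 /andP[t0 t1]; pose t' : {i01 R} := Itv01 (ltW t0) (ltW t1).
apply: le_trans (Popt _ (input_distr_mix R P z t' P01 z01)).
apply: ler_sum => y _.
have -> : out_prob n (mix_dirac P z t') y = (1 - t) * out_mix n (size s) p x y + t * binW n y z.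
  rewrite -outE /out_prob.
  exact: (fine_integral_mix _ _ _ _ t' _ (measurable_binW R n y) sP z01).
pose q' := (1 - t) * out_mix n (size s) p x y + t * binW n y z; rewrite -/q'.
have e := fine_integral_mix _ _ _ _ t' _ (measurable_xlogxq R n y q') sP z01.
rewrite (fine_integral_ord _ _ _ _ (measurable_xlogxq R n y _) sP) in e.
by rewrite e.
Qed.

(** * Numerical estimates *)

Lemma expR_pow_bound (R : realType) (n K : nat) (L : R) : (0 < n)%N -> (16 * K <= n)%N ->
  64 * K%:R ^+ 2 <= n%:R * L -> expR (- L) <= (1 - 8 * K%:R / n%:R) ^+ (4 * K).
Proof.
move=> n0 Kn KL; have nR : 0 < n%:R :> R by rewrite ltr0n.
have Kn' : 16 * K%:R <= n%:R :> R by rewrite -natrM ler_nat.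
pose u : R := 8 * K%:R / n%:R.
have u2 : u <= 1 / 2 by rewrite ler_pdivrMr //; lra.
have u0 : 0 <= u by rewrite divr_ge0 // mulr_ge0.
(* Raised to the power [4 K], this gives the exponent [2 u * 4 K = 64 K^2 / n]. *)
have h : expR (- (2 * u)) <= 1 - u.
  have v0 : 0 < 1 - u by lra.
  rewrite -[leRHS]lnK ?posrE // ler_expR; apply: le_trans (ln_ge_1subV _ _ v0).
  have -> : 1 - (1 - u)^-1 = - u / (1 - u).
    have vn := lt0r_neq0 v0; apply: (mulIf vn).
    by rewrite mulrBl mul1r mulVf // divfK // addrAC subrr add0r.
  by rewrite ler_pdivlMr //; nra.
apply: le_trans (_ : expR (- (2 * u)) ^+ (4 * K) <= _).
  rewrite -expRM_natl ler_expR /u natrM mulrN lerN2.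
  have -> : 4%:R * K%:R * (2 * (8 * K%:R / n%:R)) = 64 * K%:R ^+ 2 / n%:R :> R.
    by field; exact: lt0r_neq0.
  by rewrite ler_pdivrMr // [L * _]mulrC.
by rewrite -/u lerXn2r ?nnegrE ?expR_ge0 //; lra.
Qed.

(** With [s = ln (n + 1)], this compares [ln n / sqrt n] with [1 / ln n]. Of the two factors [e] in
    [expR (s / 2)], one absorbs [e^24] and the other beats a cubic in [s]. *)
Lemma log_scale_contra (R : realType) (s : R) : 757 <= s ->
  expR 12 * (4 * ((expR 12 + 1) * (2 * (1 + s) / expR (s / 2)))) < 757 / s.
Proof.
move=> s0; have sp : 0 < s by lra.
pose e : R := expR (s / 4).
have e12 : 1 <= expR 12 :> R by have := @expR_ge1Dx R 12; lra.
have e0 : 0 < e by exact: expR_gt0.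
have ee : expR (s / 2) = e * e by rewrite -expRD; congr expR; field.
have e24 : expR 12 * expR 12 <= e by rewrite -expRD ler_expR; lra.
(* The cubic term of the exponential series at [s / 4], with [384 = 4^3 * 3!]. *)
have e3 : s ^+ 3 / 384 <= e.
  have := @expR_ge1Dxn R (s / 4) 2; rewrite divr_ge0 ?(ltW sp) // => /(_ isT).
  rewrite (_ : 3`!%:R = 6 :> R) // => h; apply: le_trans h.
  rewrite (_ : (s / 4) ^+ 3 / 6 = s ^+ 3 / 384); last by field.
  by rewrite lerDr.
rewrite ee ltr_pdivlMr //.
apply: le_lt_trans (_ : 16 * e * ((1 + s) / (e * e)) * s < _).
  rewrite ler_pM2r //.
  have f0 : 0 <= (1 + s) / (e * e) by rewrite divr_ge0 ?mulr_ge0 ?(ltW e0) //; lra.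
  rewrite (_ : expR 12 * _ = (8 * (expR 12 * (expR 12 + 1))) * ((1 + s) / (e * e))); last by ring.
  rewrite ler_wpM2r //.
  have : expR 12 * (expR 12 + 1) <= 2 * (expR 12 * expR 12) :> R.
    by rewrite mulrDr mulr1 mulr2n mulrDl mul1r lerD2l ler_peMr // ltW ?expR_gt0.
  lra.
rewrite (_ : _ * s = 16 * (1 + s) * s / e); last by field; exact: lt0r_neq0.
rewrite ltr_pdivrMr //.
have : 16 * (1 + s) * s < 757 / 384 * s ^+ 3.
  rewrite [s ^+ 3]exprSr mulrA ltr_pM2r // expr2; nra.
lra.
Qed.

Lemma few_atoms_scale (R : realType) (n K : nat) (c : R) : (0 < n)%N -> 757 <= c ->
  let T := ln (n%:R * pi / (2 * expR 1)) in
  1 < T / c -> K%:R < 8^-1 * Num.sqrt (n%:R * ln (T / c)) ->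
  (16 * K <= n)%N /\
  expR 12 * (4 * ((expR 12 + 1) * (2 * (1 + ln n.+1%:R) / Num.sqrt n.+1%:R))) <
  (1 - 8 * K%:R / n%:R) ^+ (4 * K) :> R.
Proof.
move=> n1 c757 T T1 Klt; have c0 : 0 < c by lra.
have Tc : c < T by move: T1; rewrite ltr_pdivlMr // mul1r.
have nR : 0 < n%:R :> R by rewrite ltr0n.
(* From [pi < 4] and [2 <= e], the factor [pi / (2 e)] is at most 1. *)
have Tn : T <= ln n%:R.
  rewrite ler_ln ?posrE ?divr_gt0 ?mulr_gt0 ?pi_gt0 ?expR_gt0 //.
  rewrite ler_pdivrMr ?mulr_gt0 ?expR_gt0 // ler_pM2l //.
  have := pihalf_lt2 R; have := @expR_ge1Dx R 1; rewrite ltr_pdivrMr //; lra.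
move: T Tc Tn T1 Klt => T Tc Tn T1; set L := ln (T / c) => Klt.
have Tp : 0 < T by lra.
have Tcp : 0 < T / c by rewrite divr_gt0.
have LT : L <= T.
  apply: le_trans (ln_le_sub1 _ _ Tcp) _.
  have : T / c <= T by rewrite ler_pdivrMr // ler_peMr //; lra.
  lra.
have L0 : 0 <= L by rewrite ln_ge0 // ltW.
have nL0 : 0 <= n%:R * L by rewrite mulr_ge0.
have K2 : 64 * K%:R ^+ 2 <= n%:R * L.
  have : (8 * K%:R) ^+ 2 <= Num.sqrt (n%:R * L) ^+ 2.
    rewrite ler_sqr ?nnegrE ?sqrtr_ge0 ?mulr_ge0 //.
    by move: Klt => /ltW; rewrite ler_pdivlMl.
  by rewrite sqr_sqrtr //; apply: le_trans; rewrite !expr2; lra.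
(* The chain is [64 K^2 <= n L <= n ln n <= n^2 / 4]. *)
have Kn : (16 * K <= n)%N.
  rewrite -(ler_nat R) natrM -ler_sqr ?nnegrE ?mulr_ge0 //.
  have h : 4 * ln n%:R <= n%:R :> R.
    have := @expR_ge1Dxn R (ln n%:R) 1; rewrite lnK ?posrE // (_ : 2`!%:R = 2 :> R) //.
    have tau0 : 757 <= ln n%:R :> R by lra.
    move: (ln n%:R) tau0 => tau tau0; have t0 : 0 <= tau by lra.
    by move=> /(_ t0); rewrite expr2; nra.
  have h1 : n%:R * L <= n%:R * ln n%:R by rewrite ler_pM2l //; apply: le_trans Tn.
  have h2 : n%:R * (4 * ln n%:R) <= n%:R * n%:R :> R by rewrite ler_pM2l.
  by move: K2; rewrite !expr2; lra.
split => //; apply: lt_le_trans (expR_pow_bound _ _ _ _ n1 Kn K2).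
(* [e^-L] equals [c / T], which is at least [757 / ln (n + 1)]. *)
rewrite expRN lnK ?posrE // invf_div.
pose sg : R := ln n.+1%:R.
have nS : 0 < n.+1%:R :> R by rewrite ltr0n.
have sqE : Num.sqrt n.+1%:R = expR (sg / 2) :> R.
  rewrite -[n.+1%:R](lnK nS) -/sg [in LHS](_ : sg = sg / 2 + sg / 2); last by field.
  by rewrite expRD -expr2 sqrtr_sqr ger0_norm // expR_ge0.
have tsg : T <= sg by apply: le_trans Tn _; rewrite ler_ln ?posrE // ler_nat.
have sg0 : 757 <= sg by lra.
have sgp : 0 < sg by lra.
rewrite sqE; apply: lt_le_trans (log_scale_contra _ _ sg0) _.
apply: ler_pM; [exact: ler0n|by rewrite invr_ge0 ltW|exact: c757|by rewrite lef_pV2 ?posrE].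
Qed.

(* For a capacity-achieving P, C(n) = mutual_info n P. The support is finite
   (enumerated by the duplicate-free list s); its size is at least the bound. *)
Theorem theorem4 (R : realType) (n : nat) (P : probability R R) (s : seq R) :
  (1 <= n)%N -> capacity_achieving n P ->
  uniq s -> supp P = [set x | x \in s] ->
  theorem4_bound n (mutual_info n P) <= (size s)%:R.
Proof.
move=> n1 Pcap us sE; have [P01 _] := Pcap.
have sP := supp_carries _ _ _ P01 us sE.
pose p (i : 'I_(size s)) := mass P (nth 0 s i).
pose x (i : 'I_(size s)) := nth 0 s i.
have p0 i : 0 < p i.
  by apply: (supp_mass_gt0 _ _ _ _ sP); rewrite ?sE /= mem_nth.
have p1 : \sum_i p i = 1 by rewrite -(sum_mass _ _ _ sP) (big_nth 0) big_mkord.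
have x01 i : 0 <= x i <= 1 by have [_ _ h] := sP; apply: h; rewrite mem_nth.
have [CE opt] := capacity_achieving_opt _ _ _ _ Pcap sP.
set C := mutual_info n P in CE opt *; set K := size s in p x p0 p1 x01 CE opt *.
have Cle : C <= ln K%:R := opt_cap_le _ _ _ _ _ p0 p1 x01 CE opt.
have Cge : ln 2 <= C := opt_cap_ge _ _ _ _ _ p0 p1 x01 CE opt n1.
have K0 : 0 < K%:R :> R.
  rewrite lt_def ler0n andbT; apply: contraTneq (le_trans Cge Cle) => ->.
  by rewrite (ln0 (lexx 0)) -ltNge ln_gt0 // ltr1n.
rewrite /theorem4_bound !ge_max; apply/and3P; split.
- by rewrite -ler_ln ?posrE //; apply: le_trans Cle.
- by rewrite -[leRHS]lnK ?posrE // ler_expR.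
have c757 : 757 <= 50 * 757 :> R by apply: ler_peMl; [exact: ler0n|rewrite ler1n].
(* The numerical constant is generalised to any [c >= 757]. *)
move: c757; move: (50 * 757 : R) => c c757.
rewrite /logplus; have [_|T1] := leP (ln (n%:R * pi / (2 * expR 1)) / c) 1.
  by rewrite mulr0 sqrtr0 mulr0 ltW.
rewrite leNgt; apply/negP => Klt.
have [Kn] := few_atoms_scale _ _ _ _ n1 c757 T1 Klt; rewrite ltNge => /negP; apply.
have K8 : (8 * K <= n)%N by apply: leq_trans Kn; rewrite leq_mul2r orbT.
have K0' : (0 < K)%N by rewrite -(ltr_nat R).
exact: (kkt_atoms_bound _ _ _ _ _ _ n1 K0' K8 p0 p1 x01
  (opt_out_gt0 _ _ _ _ _ p0 p1 x01 CE opt)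
  (opt_rel_ent_le _ _ _ _ _ p0 p1 x01 CE opt)
  (opt_rel_entE _ _ _ _ _ p0 p1 x01 CE opt)).
Qed.
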